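(* Let $n\ge2$ and $c_0>0$. There exists a constant $\eta>0$, depending only on $n$ and $c_0$ (in particular independent of $\beta$ and $\Omega$), with the following property. Let $\beta\in(0,2\pi)$, let $\Omega$ be a domain contained in the sector $\mathcal{A}_\beta\subset\mathbb{R}^n$, let $\Gamma_1\subset\partial\Omega\cap\partial\mathcal{A}_\beta$ and $\Gamma_0=\partial\Omega\setminus\Gamma_1$. Let $c\in L^\infty(\Omega)$ with $\|c^+\|_{L^\infty(\Omega)}<c_0$. Assume that $w\in W^{1,2}(\Omega)$ satisfies $$\Delta w+c(x)w\ge0\ \text{ in }\Omega,\qquad w\le0\ \text{ on }\Gamma_0,\qquad \frac{\partial w}{\partial\nu}\le0\ \text{ on }\Gamma_1$$ in the weak sense, i.e. $w^+\in H_0^1(\Omega\cup\Gamma_1)$ and $$\int_\Omega\nabla w\cdot\nabla\phi\,dx-\int_\Omega c\,w\,\phi\,dx\le0\qquad\text{for all }\phi\in H_0^1(\Omega\cup\Gamma_1),\ \phi\ge0.$$ If $\operatorname{meas}(\Omega)<\eta\beta$, then $w\le0$ in $\Omega$.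
   Context: The sector of amplitude $\beta$ is $\mathcal{A}_\beta=\{x\in\mathbb{R}^n:\theta_1,\dots,\theta_{n-2}\in(0,\pi),\ \theta_{n-1}\in(0,\beta)\}$ in the usual polar coordinates $(r,\theta_1,\dots,\theta_{n-1})$ of $\mathbb{R}^n$, that is, the set of $x$ with $(x_{n-1},x_n)=(\varrho\cos\theta,\varrho\sin\theta)$ for some $\varrho>0$, $\theta\in(0,\beta)$. $c^+=\max\{c,0\}$, $w^+=\max\{w,0\}$. $H_0^1(\Omega\cup\Gamma_1)$ is the closure in $W^{1,2}(\Omega)$ of the restrictions to $\Omega$ of functions $\varphi\in C_c^\infty(\mathbb{R}^n)$ for which $\operatorname{supp}\varphi\cap\overline{\Omega}$ is a compact subset of $\Omega\cup\Gamma_1$. The domain $\Omega$ may be bounded or unbounded. *)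

(* Defs.v *)
From HB Require Import structures.
From mathcomp Require Import all_boot all_order all_algebra.
From mathcomp Require Import all_classical all_reals all_analysis.

Set Implicit Arguments.
Unset Strict Implicit.
Unset Printing Implicit Defensive.

Import Order.TTheory GRing.Theory Num.Theory.
Import numFieldNormedType.Exports.

Local Open Scope classical_set_scope.
Local Open Scope ring_scope.

Definition measure_rV_display : measure_display.
Proof. exact: default_measure_display. Qed.

(* R^n = 'rV[R]_n carries the sigma-algebra generated by the coordinate maps,
   i.e. its Borel sigma-algebra; this mirrors the library's measurable structure
   on n.-tuple T. *)
Section measurable_rV.
Variables (R : realType) (n : nat).

Definition coord_rV (i : 'I_n) (v : 'rV[R]_n) : measurableTypeR R := v ord0 i.

Let rV_set0 : g_sigma_preimage coord_rV set0.
Proof. exact: sigma_algebra0. Qed.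

Let rV_setC A : g_sigma_preimage coord_rV A -> g_sigma_preimage coord_rV (~` A).
Proof. exact: sigma_algebraC. Qed.

Let rV_bigcup (F : (set 'rV[R]_n)^nat) :
  (forall i, g_sigma_preimage coord_rV (F i)) ->
  g_sigma_preimage coord_rV (\bigcup_i (F i)).
Proof. exact: sigma_algebra_bigcup. Qed.

HB.instance Definition _ := @isMeasurable.Build measure_rV_display
  'rV[R]_n (g_sigma_preimage coord_rV) rV_set0 rV_setC rV_bigcup.

Lemma measurable_coord_rV i : measurable_fun [set: 'rV[R]_n] (coord_rV i).
Proof.
move=> _ Y mY; rewrite setTI; apply: sub_sigma_algebra => /=.
rewrite -bigcup_seq/=; exists i => /=; first by rewrite mem_index_enum.
by exists Y => //; rewrite setTI.
Qed.

Lemma measurable_fun_rV d (T : measurableType d) (f : T -> 'rV[R]_n) :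
  (forall i, measurable_fun setT (coord_rV i \o f)) -> measurable_fun setT f.
Proof.
move=> mf _ A mA; rewrite setTI.
suff: g_sigma_preimage coord_rV `<=` [set B | measurable (f @^-1` B)] by exact.
apply: smallest_sub.
  split=> [|B mB|F mF] /=; first by rewrite preimage_set0.
  - by rewrite setTD -preimage_setC; exact: measurableC.
  - by rewrite preimage_bigcup; apply: bigcup_measurable => k _; exact: mF.
move=> B; rewrite /= -bigcup_seq => -[i _ [C mC <-]] /=.
by rewrite setTI -comp_preimage -[X in measurable X]setTI; exact: mf.
Qed.

End measurable_rV.

Section cons_rV.
Variables (R : realType) (n : nat).

Definition cons_rV (p : measurableTypeR R * 'rV[R]_n) : 'rV[R]_n.+1 :=
  row_mx (p.1)%:M p.2.

Definition uncons_rV (v : 'rV[R]_n.+1) : measurableTypeR R * 'rV[R]_n :=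
  (v ord0 ord0, rsubmx (v : 'rV_(1 + n))).

Lemma cons_rVK : cancel cons_rV uncons_rV.
Proof.
move=> [x v]; rewrite /uncons_rV /cons_rV /= row_mxKr; congr pair.
have -> : (ord0 : 'I_(1 + n)) = lshift n ord0 by exact/val_inj.
by rewrite (row_mxEl (x%:M : 'rV_1)) mxE.
Qed.

Lemma measurable_cons_rV : measurable_fun setT cons_rV.
Proof.
apply: measurable_fun_rV => i.
case: (split_ordP (i : 'I_(1 + n))) => j ->.
- rewrite (_ : _ \o _ = fst); first exact: measurable_fst.
  apply/funext => -[x v] /=.
  by rewrite /coord_rV /cons_rV (row_mxEl (x%:M : 'rV_1)) mxE [j]ord1 eqxx.
- rewrite (_ : _ \o _ = coord_rV j \o snd).
    exact: (measurableT_comp (@measurable_coord_rV R n j) measurable_snd).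
  apply/funext => -[x v] /=.
  by rewrite /coord_rV /cons_rV (row_mxEr (x%:M : 'rV_1)).
Qed.

Lemma measurable_uncons_rV : measurable_fun setT uncons_rV.
Proof.
apply: measurable_fun_pair => /=; first exact: (measurable_coord_rV ord0).
apply: measurable_fun_rV => i.
rewrite (_ : _ \o _ = coord_rV (rshift 1 i : 'I_n.+1)).
  exact: measurable_coord_rV.
by apply/funext => v; rewrite /coord_rV /= mxE.
Qed.

End cons_rV.

Section cons_measure.
Variables (R : realType) (n : nat).
Variable mu : {sigma_finite_measure set 'rV[R]_n -> \bar R}.

(* lebesgue_measure \x mu, seen as a measure on R^(n+1) *)
Definition cons_measure : set 'rV[R]_n.+1 -> \bar R :=
  pushforward (@lebesgue_measure R \x mu)%E (@cons_rV R n).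

Let prod_cons : {measure set 'rV[R]_n.+1 -> \bar R} :=
  measure_function_pushforward__canonical__measure_function_Measure
    (@lebesgue_measure R \x mu)%E (@measurable_cons_rV R n).

HB.instance Definition _ := isMeasure.Build _ _ _ cons_measure
  (measure0 prod_cons) (measure_ge0 prod_cons)
  (@measure_semi_sigma_additive _ _ _ prod_cons).

Let cons_measure_sigma_finite : sigma_finite setT cons_measure.
Proof.
have /sigma_finiteP[F [TF ndF Foo]] := sigma_finiteT (@lebesgue_measure R).
have /sigma_finiteP[G [TG ndG Goo]] := sigma_finiteT mu.
exists (fun k => @uncons_rV R n @^-1` (F k `*` G k)).
  rewrite -preimage_bigcup (_ : \bigcup_k _ = setT) ?preimage_setT//.
  rewrite -subTset => -[x y] _.
  have [k _ Fkx] : (\bigcup_k F k) x by rewrite -TF.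
  have [l _ Gly] : (\bigcup_k G k) y by rewrite -TG.
  exists (maxn k l) => //; split => /=.
  - by move: x Fkx; exact/subsetPset/ndF/leq_maxl.
  - by move: y Gly; exact/subsetPset/ndG/leq_maxr.
move=> k; have [mFk Fkoo] := Foo k; have [mGk Gkoo] := Goo k; split.
  rewrite -[X in measurable X]setTI.
  by apply: measurable_uncons_rV => //; exact: measurableX.
rewrite /cons_measure /pushforward -comp_preimage.
rewrite (_ : _ \o _ = id); last by apply/funext; exact: cons_rVK.
by rewrite preimage_id product_measure1E// lte_mul_pinfty// ge0_fin_numE.
Qed.

HB.instance Definition _ := Measure_isSigmaFinite.Build _ _ _ cons_measure
  cons_measure_sigma_finite.

End cons_measure.

Section lebesgue_rV.
Variable R : realType.

Fixpoint lebesgue_rV (n : nat) : {sigma_finite_measure set 'rV[R]_n -> \bar R} :=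
  match n with
  | 0 => \d_(0 : 'rV[R]_0)
  | m.+1 => cons_measure (lebesgue_rV m)
  end.

End lebesgue_rV.

Section sobolev.
Variables (R : realType) (n : nat).
Implicit Types (Om G : set 'rV[R]_n) (u phi : 'rV[R]_n -> R).
Implicit Types (Du : 'I_n -> 'rV[R]_n -> R).

Local Notation mu := (lebesgue_rV R n).

Definition is_domain Om := [/\ open Om, connected Om & Om !=set0].

Definition bdry (A : set 'rV[R]_n) := closure A `\` interior A.

Definition partial (i : 'I_n) phi : 'rV[R]_n -> R := 'D_(delta_mx ord0 i) phi.

Definition smooth phi := forall s : seq 'I_n,
  let psi := foldr partial phi s in
  continuous psi /\ forall i x, derivable psi x (delta_mx ord0 i).

Definition supp phi := closure [set x | phi x != 0].

Definition Cc_smooth phi := smooth phi /\ compact (supp phi).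

Definition Lp Om (p : \bar R) u := u \_ Om \in Lfun mu p.

(* u belongs to W^{1,2}(Om), with weak gradient Du. The gradient, unique only
   almost everywhere, is carried along explicitly. *)
Definition W12 Om u Du :=
  [/\ Lp Om 2%:E u,
      forall i, Lp Om 2%:E (Du i) &
      forall phi, Cc_smooth phi -> supp phi `<=` Om -> forall i,
        \int[mu]_(x in Om) (u x * partial i phi x) =
        - \int[mu]_(x in Om) (Du i x * phi x)].

Definition W12_norm Om u Du : \bar R :=
  ((\int[mu]_(x in Om) (u x ^+ 2 + \sum_i Du i x ^+ 2)%:E) `^ 2^-1)%E.

Definition H10_test Om G phi :=
  [/\ Cc_smooth phi, compact (supp phi `&` closure Om) &
      supp phi `&` closure Om `<=` Om `|` G].

(* u belongs to H_0^1(Om `|` G), the closure of the H10_test functions for the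
   W^{1,2}(Om)-norm, with weak gradient Du. *)
Definition H10 Om G u Du :=
  W12 Om u Du /\
  forall eps : R, 0 < eps -> exists2 phi, H10_test Om G phi &
    (W12_norm Om (u \- phi)%R (fun i => Du i \- partial i phi)%R < eps%:E)%E.

(* the sector of amplitude beta; i and j are the 0-based indices of the last two
   coordinates *)
Definition sector (beta : R) : set 'rV[R]_n :=
  [set x | exists i j : 'I_n, [/\ i.+2 = n, j.+1 = n &
    exists rho theta : R, [/\ 0 < rho, 0 < theta < beta,
      x ord0 i = rho * cos theta & x ord0 j = rho * sin theta]]].

End sobolev.

Arguments sector {R} n beta.

(* Main.v *)
Require Import Defs.
From HB Require Import structures.
From mathcomp Require Import all_boot all_order all_algebra.
From mathcomp Require Import all_classical all_reals all_analysis.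
From mathcomp Require Import ring lra measurable_realfun ess_sup_inf.

Set Implicit Arguments.
Unset Strict Implicit.
Unset Printing Implicit Defensive.

Import Order.TTheory GRing.Theory Num.Theory.
Import numFieldNormedType.Exports.

Local Open Scope classical_set_scope.
Local Open Scope ring_scope.

(** Testing the inequality with the positive part u of w gives, once
    |grad u|^2 <= grad w . grad u is known,

      int |grad u|^2 <= int c u^2 <= c0 int u^2.

    A Poincare inequality int u^2 <= 4 C int |grad u|^2 with 4 C c0 <= 1/2 then
    forces u = 0. So there are two things to prove: that C can be made small with
    a threshold for the measure of the domain that is linear in beta, and the
    inequality between the gradients.

    Poincare inequality. A test function extended by zero is smooth in the open
    sector, whatever the regularity of the domain, since it vanishes near the part
    of the boundary inside the sector (test_near0). Suppose that an open set K is
    mapped into itself by the translations by all vectors h of a box H, each of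
    them performed one coordinate after the other. Averaging
    u(x)^2 = (u(x + h) - u(x))^2 over the h for which x + h lies outside the
    domain, at least half of H when the domain has at most half the measure of H,
    bounds int_K u^2 by the derivatives of u on K, with a constant governed by the
    diameter of H and not by K (poincare_box). The sector fits this scheme. If
    beta < pi it is the set of the x with x_(n-1) and x_n in a convex angle, which
    is stable under the vectors of the angle, and the angle contains a box with
    sides a and a beta / 8. If beta >= pi it is the union of two half-spaces, and
    each of them is stable under the translations by a cube of side a. In both
    cases the measure of H is at least 2 (a^n / 16) beta, so eta = a^n / 16 works
    for every beta, and C = 16 n a^2 is small when a is (poincare_sector). The
    closure in the Sobolev norm costs a factor 4 (poincare_H10).

    Gradient of the positive part. For real numbers a and b the increment of the
    positive part, p = max(a, 0) - max(b, 0), satisfies p (p - (a - b)) <= 0. It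
    is therefore enough to know that the weak derivatives of w and of u are almost
    everywhere limits of difference quotients along a fixed sequence of increments
    (W12_difference_quotient). For a fixed increment h the weak derivative is
    tested with products of bumps, one factor of which is averaged over a segment
    of length h; letting the bumps tend to indicators of boxes identifies
    w(x + h e_i) - w(x) with the integral of the weak derivative along the segment,
    for almost every x (weak_increment). Almost every point is a Lebesgue point on
    its line in direction e_i (ae_lebesgue_line), and dividing by h concludes. *)

(** * Boxes, open sets and translations *)

Section boxes.
Variables (R : realType) (n : nat).
Implicit Types (l r : 'I_n -> R) (x v : 'rV[R]_n).
Local Notation mu := (lebesgue_rV R n).

Definition box l r : set 'rV[R]_n := [set x | forall j, l j < x ord0 j < r j].

Lemma measurable_box l r : measurable (box l r).
Proof.
rewrite (_ : box l r = \bigcap_(j in [set: 'I_n]) (coord_rV j @^-1` `]l j, r j[)).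
  apply: fin_bigcap_measurable; first exact: finite_finset.
  move=> j _; rewrite -[X in measurable X]setTI.
  by apply: measurable_coord_rV => //; exact: measurable_itv.
apply/seteqP; split => [x bx j _ /=|x bx j].
  by rewrite in_itv/=; exact: bx.
by have := bx j I; rewrite /= in_itv.
Qed.

Lemma setI_box l r l' r' :
  box l r `&` box l' r' = box (fun j => Num.max (l j) (l' j))
                              (fun j => Num.min (r j) (r' j)).
Proof.
apply/seteqP; split=> [x [h h'] j|x h].
  by rewrite gt_max lt_min; have /andP[-> ->] := h j; have /andP[-> ->] := h' j.
by split=> j; have := h j; rewrite gt_max lt_min => /andP[/andP[? ?] /andP[? ?]];
  apply/andP.
Qed.

Lemma bigcup_box_setT :
  \bigcup_(k : nat) box (fun=> - k%:R) (fun=> k%:R) = [set: 'rV[R]_n].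
Proof.
rewrite -subTset => x _.
pose M : R := \sum_j `|x ord0 j|.
exists (Num.bound M) => // j.
have xM : `|x ord0 j| < (Num.bound M)%:R.
  apply: (@le_lt_trans _ _ M).
    by rewrite /M (bigD1 j)//= lerDl sumr_ge0.
  by rewrite archi_boundP// sumr_ge0.
by rewrite -ltr_norml.
Qed.

(** The boxes are stable under intersection, so that two measures that agree on
    them are equal. *)
Lemma sigma_box :
  @measurable _ 'rV[R]_n = <<s [set B | exists l r, B = box l r] >>.
Proof.
set G := [set B | _].
apply/seteqP; split; last first.
  apply: smallest_sub; first exact: sigma_algebra_measurable.
  by move=> _ [l [r ->]]; exact: measurable_box.
apply: smallest_sub; first exact: smallest_sigma_algebra.
rewrite -bigcup_seq/= => _ [j _ [C mC <-]].
have : measurable_fun [set: g_sigma_algebraType G] (coord_rV j : _ -> measurableTypeR R).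
  apply: (measurability _ (RGenOpens.measurableE R)).
  move=> _ [_ [a [b ->] <-]].
  rewrite setTI.
  pose F (k : nat) := box (fun i => if i == j then a else - k%:R)
                          (fun i => if i == j then b else k%:R).
  rewrite (_ : _ @^-1` _ = \bigcup_k F k); last first.
    apply/seteqP; split=> [x /=|x [k _ /(_ j)]]; rewrite /= /coord_rV in_itv/=.
      move=> xab; have : setT x by [].
      rewrite -bigcup_box_setT => -[k _ kx]; exists k => // i.
      by case: eqP => [->//|_]; exact: kx.
    by rewrite eqxx.
  apply: bigcupT_measurable => k; apply: sub_sigma_algebra.
  by do 2!eexists.
by move=> /(_ measurableT C mC).
Qed.

Definition cube (q : 'rV[rat]_n) (k : nat) (c : R) : set 'rV[R]_n :=
  box (fun j => ratr (q ord0 j) - c / k.+1%:R)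
      (fun j => ratr (q ord0 j) + c / k.+1%:R).

(** Asking for a concentric cube of twice the size inside U leaves room for small
    translations of the points of the smaller one. *)
Lemma open_cube (U : set 'rV[R]_n) x : open U -> U x ->
  exists q k, cube q k 1 x /\ cube q k 2 `<=` U.
Proof.
rewrite openE => /(_ x) /[apply] /nbhs_ballP[e /= e0 eU].
pose k := Num.bound (e^-1 * 3).
have k0 : (0 : R) < k.+1%:R by rewrite ltr0n.
have ke : 3 / k.+1%:R < e.
  rewrite ltr_pdivrMr// -ltr_pdivrMl//.
  apply: lt_le_trans (archi_boundP _) _; last by rewrite ler_nat.
  by rewrite mulr_ge0// invr_ge0 ltW.
have /choice[q qP] : forall j : 'I_n, exists q : rat,
    x ord0 j - 1 / k.+1%:R < ratr q < x ord0 j + 1 / k.+1%:R.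
  move=> j; have /rat_in_itvoo[q] : x ord0 j - 1 / k.+1%:R < x ord0 j + 1 / k.+1%:R.
    by rewrite ltrD2l gtrN// divr_gt0.
  by rewrite in_itv/=; exists q.
exists (\row_j q j), k; split=> [j|y yc].
  rewrite mxE; have := qP j; move: (k.+1%:R^-1 : R) => t /andP[q1 q2].
  by apply/andP; split; lra.
apply: eU; split=> // i j; rewrite [i]ord1 /ball/=.
have := yc j; rewrite mxE => /andP[y1 y2]; have /andP[q1 q2] := qP j.
move: ke q1 q2 y1 y2; move: (k.+1%:R^-1 : R) => t ke q1 q2 y1 y2.
by rewrite ltr_norml; apply/andP; split; lra.
Qed.

Lemma open_bigcup_cube (U : set 'rV[R]_n) : open U ->
  U = \bigcup_(p in [set p | cube p.1 p.2 2 `<=` U]) cube p.1 p.2 1.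
Proof.
move=> oU; apply/seteqP; split => [x Ux|x [[q k] /= qk xq]].
  by have [q [k [? ?]]] := open_cube oU Ux; exists (q, k).
apply: qk => j; have := xq j => /andP[h1 h2].
have : (0 : R) < k.+1%:R^-1 by rewrite invr_gt0 ltr0n.
move: (k.+1%:R^-1 : R) h1 h2 => t h1 h2 t0.
by apply/andP; split; lra.
Qed.

Lemma open_measurable_rV (U : set 'rV[R]_n) : open U -> measurable U.
Proof.
move=> oU; rewrite (open_bigcup_cube oU) bigcup_mkcond.
apply: countable_bigcupT_measurable; first exact: countableP.
by move=> [q k]; case: ifP => // _; exact: measurable_box.
Qed.

Lemma continuous_measurable_rV (f : 'rV[R]_n -> R) :
  continuous f -> measurable_fun setT (f : _ -> measurableTypeR R).
Proof.
move=> /continuousP cf.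
apply: (measurability _ (RGenOpens.measurableE R)) => _ [_ [a [b ->] <-]].
by rewrite setTI; apply: open_measurable_rV; exact/cf/interval_open.
Qed.

Lemma measurable_rV_add : measurable_fun setT
  (fun p : 'rV[R]_n * 'rV[R]_n => p.1 + p.2).
Proof.
apply: measurable_fun_rV => i.
rewrite (_ : _ \o _ = (fun p => coord_rV i p.1 + coord_rV i p.2)).
  apply: (@measurable_funD _ _ R).
    exact: (measurableT_comp (measurable_coord_rV i) measurable_fst).
  exact: (measurableT_comp (measurable_coord_rV i) measurable_snd).
by apply/funext => p; rewrite /coord_rV /= mxE.
Qed.

Lemma measurable_rV_addr v : measurable_fun setT (fun x => x + v).
Proof.
exact: (measurableT_comp measurable_rV_add (pair2_measurable v)).
Qed.

Lemma measurable_rV_scale v :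
  measurable_fun setT (fun s : measurableTypeR R => s *: v).
Proof.
apply: measurable_fun_rV => i.
rewrite (_ : _ \o _ = (fun s => s * v ord0 i)).
  by apply: (@measurable_funM _ _ R) => //; exact: measurable_id.
by apply/funext => p; rewrite /coord_rV /= mxE.
Qed.

Lemma measurable_rV_line v : measurable_fun setT
  (fun p : 'rV[R]_n * measurableTypeR R => p.1 + p.2 *: v).
Proof.
have h : measurable_fun setT
    (fun p : 'rV[R]_n * measurableTypeR R => (p.1, p.2 *: v)).
  apply: measurable_fun_pair; first exact: measurable_fst.
  exact: (measurableT_comp (measurable_rV_scale v) measurable_snd).
exact: (measurableT_comp measurable_rV_add h).
Qed.

End boxes.

Section box_measure.
Variable R : realType.

Lemma lebesgue_measure_oo (a b : R) :
  lebesgue_measure (`]a, b[%classic : set R) = (Num.max 0 (b - a))%:E.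
Proof.
rewrite lebesgue_measure_itv/= lte_fin -EFinB.
case: ltP => ab; last by rewrite max_l// subr_le0.
by rewrite max_r// subr_ge0 ltW.
Qed.

Lemma cons_rV0 n (x : R) (y : 'rV[R]_n) : cons_rV (x, y) ord0 ord0 = x.
Proof.
rewrite /cons_rV; have -> : (ord0 : 'I_(1 + n)) = lshift n ord0 by exact/val_inj.
by rewrite (row_mxEl (x%:M : 'rV_1)) mxE.
Qed.

Lemma cons_rV_lift n (x : R) (y : 'rV[R]_n) j :
  cons_rV (x, y) ord0 (lift ord0 j) = y ord0 j.
Proof.
rewrite /cons_rV.
have -> : (lift ord0 j : 'I_(1 + n)) = rshift 1 j by exact/val_inj.
by rewrite (row_mxEr (x%:M : 'rV_1)).
Qed.

Lemma lebesgue_box n (l r : 'I_n -> R) :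
  lebesgue_rV R n (box l r) = (\prod_j Num.max 0 (r j - l j))%:E.
Proof.
elim: n l r => [|n ih] l r.
  by rewrite big_ord0 /= diracE mem_set// => -[].
rewrite big_ord_recl EFinM -lebesgue_measure_oo.
transitivity ((@lebesgue_measure R \x lebesgue_rV R n)%E
    (`]l ord0, r ord0[%classic `*` box (l \o lift ord0) (r \o lift ord0))).
  rewrite /= /cons_measure /pushforward; congr (_ _).
  apply/seteqP; split=> -[x y] /=.
    move=> h; split; first by have := h ord0; rewrite in_itv/= cons_rV0.
    by move=> j; have := h (lift ord0 j); rewrite cons_rV_lift.
  rewrite in_itv/= => -[xlr yb] j.
  case: (unliftP ord0 j) => [i ->|->]; last by rewrite cons_rV0.
  by rewrite cons_rV_lift; exact: yb.
rewrite product_measure1E; [|exact: measurable_itv|exact: measurable_box].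
by congr (_ * _)%E; rewrite ih.
Qed.

End box_measure.

Section translation.
Variables (R : realType) (n : nat).
Local Notation mu := (lebesgue_rV R n).

Lemma lebesgue_rV_translate (v : 'rV[R]_n) A : measurable A ->
  mu ((fun x => x + v) @^-1` A) = mu A.
Proof.
move=> mA; apply/esym.
pose nu : {measure set 'rV[R]_n -> \bar R} :=
  measure_function_pushforward__canonical__measure_function_Measure
    mu (measurable_rV_addr v).
change (mu A = nu A).
apply: (measure_unique [set B | exists l r, B = box l r]
  (fun k => box (fun=> - k%:R) (fun=> k%:R))) => //.
- exact: sigma_box.
- move=> _ _ [l [r ->]] [l' [r' ->]]; rewrite setI_box.
  by do 2!eexists.
- by move=> k; do 2!eexists.
- exact: bigcup_box_setT.
- move=> _ [l [r ->]]; rewrite /nu/= /pushforward.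
  rewrite (_ : _ @^-1` _ = box (fun j => l j - v ord0 j) (fun j => r j - v ord0 j)).
    rewrite !lebesgue_box; congr EFin; apply: eq_bigr => j _; congr (Num.max _ _).
    by rewrite opprB addrA subrK.
  by apply/seteqP; split=> x /= h j; have := h j; rewrite mxE ltrBlDr ltrBrDr.
- by move=> k; rewrite [ltLHS](lebesgue_box _ _) ltry.
Qed.

Lemma ge0_integral_translate (v : 'rV[R]_n) (f : 'rV[R]_n -> \bar R) :
  measurable_fun setT f -> (forall x, 0 <= f x)%E ->
  (\int[mu]_x f (x + v)%R = \int[mu]_x f x)%E.
Proof.
move=> mf f0.
have := ge0_integral_pushforward (measurable_rV_addr v) mu
  measurableT mf (fun x _ => f0 x).
rewrite preimage_setT => <-.
apply: (eq_measure_integral mu (m1 :=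
  measure_function_pushforward__canonical__measure_function_Measure
    mu (measurable_rV_addr v))) => A mA _.
exact: lebesgue_rV_translate.
Qed.

End translation.

(** * Increments along segments *)

Section increments.
Variable R : realType.

Lemma is_derive1_comp (f g : R -> R) (x df dg : R) :
  is_derive x 1 f df -> is_derive (f x) 1 g dg ->
  is_derive x (1 : R) (g \o f) (dg * df).
Proof.
move=> [fx <-] [gx <-]; split.
  apply: (derivable1_diffP (g \o f) x).2; apply: differentiable_comp.
    exact: ((derivable1_diffP f x).1 fx).
  exact: ((derivable1_diffP g (f x)).1 gx).
rewrite -(derive1E g) -(derive1E f) -(derive1E (g \o f)).
exact: (derive1_comp fx gx).
Qed.

Lemma is_derive_lineP n (f : 'rV[R]_n -> R) (x v : 'rV[R]_n) (df : R) :
  is_derive x v f df <-> is_derive (0 : R) (1 : R) (fun s => f (s *: v + x)) df.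
Proof.
have E : 'D_v f x = 'D_1 (fun s : R => f (s *: v + x)) 0.
  set q := fun s => _; rewrite /derive.
  rewrite [in RHS](_ : (fun h => _) = (fun h : R => h^-1 *: ((f \o shift x) (h *: v) - f x)))//.
  by apply/funext => h; rewrite /q/= scale0r add0r addr0 [h *: 1]mulr1.
split=> -[d1 d2]; split.
- exact: ((derivable1P f x v).1 d1).
- by rewrite -E.
- exact: ((derivable1P f x v).2 d1).
- by rewrite E.
Qed.

(** Cauchy-Schwarz for the fundamental theorem of calculus, with the pointwise
    bound f^2 >= 2 D f - D^2, for D the increment, in place of Hoelder. *)
Lemma sqr_increment_le (F f : R -> R) :
  (forall t : R, 0 <= t <= 1 -> is_derive t (1 : R) F (f t)) ->
  (forall t : R, 0 <= t <= 1 -> {for t, continuous f}) ->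
  (((F 1 - F 0) ^+ 2)%:E <= \int[lebesgue_measure]_(t in `[0%R, 1%R]) (f t ^+ 2)%:E)%E.
Proof.
move=> dF cf; set D := F 1 - F 0.
have cfw (g : R -> R) : (forall t : R, 0 <= t <= 1 -> {for t, continuous g}) ->
    {within `[0, 1], continuous g}.
  by move=> cg; apply: continuous_in_subspaceT => t; rewrite inE/= in_itv/=; exact: cg.
pose G t := 2 * D * F t - D ^+ 2 * t.
pose g t := 2 * D * f t - D ^+ 2.
have dG (t : R) : 0 <= t <= 1 -> is_derive t (1 : R) G (g t).
  move=> t01; have dFt := dF t t01.
  have -> : g t = (2 * D) *: f t - D ^+ 2 *: (1 : R).
    by rewrite /g /GRing.scale/= mulr1.
  exact: (is_deriveB (is_deriveZ (2 * D) dFt)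
                     (is_deriveZ (D ^+ 2) (is_derive_id t (1 : R)))).
have cg (t : R) : 0 <= t <= 1 -> {for t, continuous g}.
  move=> t01; apply: cvgB; last exact: cvg_cst.
  by apply: cvgM; [exact: cvg_cst|exact: cf].
have cG (t : R) : 0 <= t <= 1 -> {for t, continuous G}.
  move=> t01; apply/differentiable_continuous/derivable1_diffP.
  by have [] := dG t t01.
have FTC : (\int[lebesgue_measure]_(t in `[0%R, 1%R]) (g t)%:E = (G 1)%:E - (G 0)%:E)%E.
  apply: continuous_FTC2 => //; first exact: cfw.
    split.
    - move=> t; rewrite in_itv/= => /andP[t0 t1].
      by have [] := dG t; rewrite ?ltW.
    - by apply: cvg_at_right_filter; apply: cG; rewrite lexx ler01.
    - by apply: cvg_at_left_filter; apply: cG; rewrite lexx ler01.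
  move=> t; rewrite in_itv/= => /andP[t0 t1].
  have dGt : is_derive t (1 : R) G (g t) by apply: dG; rewrite !ltW.
  by rewrite derive1E derive_val.
have -> : ((D ^+ 2)%:E = \int[lebesgue_measure]_(t in `[0%R, 1%R]) (g t)%:E)%E.
  by rewrite FTC -EFinB /G /D; congr EFin; ring.
apply: le_integral => //.
- apply: continuous_compact_integrable; first exact: segment_compact.
  exact: cfw.
- apply: continuous_compact_integrable; first exact: segment_compact.
  apply: (cfw (fun t => f t ^+ 2)) => t t01.
  by apply: (@continuous_comp _ _ _ f (fun x => x ^+ 2)); [exact: cf|exact: exprn_continuous].
- move=> t _; rewrite lee_fin /g -subr_ge0.
  by rewrite (_ : _ - _ = (f t - D) ^+ 2) ?sqr_ge0//; ring.
Qed.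

Variable n : nat.
Local Notation mu := (lebesgue_rV R n).
Local Notation "''e_' j" := (delta_mx ord0 j : 'rV[R]_n) (at level 8, j at level 2).

Lemma measurable_integral_line (D : set R) (v w : 'rV[R]_n)
    (F : 'rV[R]_n -> \bar R) :
  measurable D -> measurable_fun setT F -> (forall x, 0 <= F x)%E ->
  measurable_fun setT
    (fun x : 'rV[R]_n => \int[lebesgue_measure]_(t in D) F (x + v + t *: w)%R)%E.
Proof.
move=> mD mF F0.
pose H (p : 'rV[R]_n * measurableTypeR R) :=
  (F (p.1 + p.2 *: w + v)%R * (\1_D p.2)%:E)%E.
have mline : measurable_fun setT
    (fun p : 'rV[R]_n * measurableTypeR R => p.1 + p.2 *: w + v).
  exact: (measurableT_comp (measurable_rV_addr v) (measurable_rV_line w)).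
have mH : measurable_fun setT H.
  apply: emeasurable_funM; first exact: (measurableT_comp mF mline).
  apply/measurable_EFinP; apply: (measurableT_comp _ measurable_snd).
  exact: measurable_indic.
have H0 p : (0 <= H p)%E by rewrite mule_ge0.
rewrite (_ : (fun x => _) = fubini_F lebesgue_measure H).
  exact: measurable_fun_fubini_tonelli_F.
apply/funext => x; rewrite /fubini_F [LHS]integral_mkcond epatch_indic.
by apply: eq_integral => t _; rewrite /H/= addrAC.
Qed.

(** By Tonelli and translation invariance: each translate of F has the integral
    of F, and averaging over a segment of translates costs nothing. *)
Lemma ge0_integral_line (D : set R) (v w : 'rV[R]_n) (F : 'rV[R]_n -> \bar R) :
  measurable D -> measurable_fun setT F -> (forall x, 0 <= F x)%E ->
  (\int[mu]_x \int[lebesgue_measure]_(t in D) F (x + v + t *: w)%R =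
   lebesgue_measure D * \int[mu]_x F x)%E.
Proof.
move=> mD mF F0.
pose H (p : 'rV[R]_n * measurableTypeR R) :=
  (F (p.1 + p.2 *: w + v)%R * (\1_D p.2)%:E)%E.
have mline : measurable_fun setT
    (fun p : 'rV[R]_n * measurableTypeR R => p.1 + p.2 *: w + v).
  exact: (measurableT_comp (measurable_rV_addr v) (measurable_rV_line w)).
have mH : measurable_fun setT H.
  apply: emeasurable_funM; first exact: (measurableT_comp mF mline).
  apply/measurable_EFinP; apply: (measurableT_comp _ measurable_snd).
  exact: measurable_indic.
have H0 p : (0 <= H p)%E by rewrite mule_ge0.
transitivity (\int[mu]_x \int[lebesgue_measure]_t H (x, t))%E.
  apply: eq_integral => x _; rewrite integral_mkcond epatch_indic.
  by apply: eq_integral => t _; rewrite /H/= addrAC.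
rewrite fubini_tonelli//.
have E t : (\int[mu]_x H (x, t) = (\int[mu]_x F x) * (\1_D t)%:E)%E.
  have mFt : measurable_fun setT (fun x : 'rV[R]_n => F (x + (t *: w + v))).
    exact: (measurableT_comp mF (measurable_rV_addr _)).
  rewrite -(ge0_integral_translate (t *: w + v) mF)// -ge0_integralZr//.
  by apply: eq_integral => x _; rewrite /H/= addrA.
under eq_integral do rewrite E.
rewrite ge0_integralZl//.
- by rewrite integral_indic// setIT muleC.
- by apply/measurable_EFinP; exact: measurable_indic.
- exact: integral_ge0.
Qed.

End increments.

(** * A Poincare inequality from a box of translations *)

Lemma sqr_sum_le (R : realFieldType) (n : nat) (a : 'I_n -> R) :
  (\sum_i a i) ^+ 2 <= n%:R * \sum_i a i ^+ 2.
Proof.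
rewrite expr2 mulr_suml.
have -> : n%:R * \sum_i a i ^+ 2 =
    \sum_i \sum_j ((a i ^+ 2 + a j ^+ 2) / 2).
  under [RHS]eq_bigr => i _ do rewrite -mulr_suml big_split/= sumr_const card_ord.
  rewrite -mulr_suml big_split/= sumr_const card_ord sumrMnl -(mulr_natl (\sum_i a i ^+ 2) n).
  by field.
apply: ler_sum => i _; rewrite mulr_sumr; apply: ler_sum => j _.
rewrite -subr_ge0 (_ : _ - _ = (a i - a j) ^+ 2 / 2); last by field.
by rewrite divr_ge0 ?sqr_ge0.
Qed.

Section poincare.
Variables (R : realType) (n : nat).
Local Notation mu := (lebesgue_rV R n).
Local Notation "''e_' j" := (delta_mx ord0 j : 'rV[R]_n) (at level 8, j at level 2).
Variables (K : set 'rV[R]_n) (u : 'rV[R]_n -> R) (g : 'I_n -> 'rV[R]_n -> R).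
Hypotheses (mK : measurable K) (mu_ : measurable_fun setT u).
Hypothesis mg : forall j, measurable_fun setT (g j).
Hypothesis du : forall x, K x -> forall j, is_derive x 'e_j u (g j x).
Hypothesis cg : forall x, K x -> forall j, {for x, continuous (g j)}.

Lemma is_derive_line (x : 'rV[R]_n) (j : 'I_n) (s t : R) : K (x + t *: (s *: 'e_j)) ->
  is_derive t (1 : R) (fun t => u (x + t *: (s *: 'e_j)))
    (g j (x + t *: (s *: 'e_j)) * s).
Proof.
move=> Ky; set y := x + _ in Ky *.
pose q (h : R) := u (h *: 'e_j + y).
have dq : is_derive (0 : R) (1 : R) q (g j y) := (is_derive_lineP _ _ _ _).1 (du Ky j).
pose a (r : R) := s * (r - t).
have da : is_derive t (1 : R) a s.
  have := is_deriveZ s (is_deriveB (is_derive_id t (1 : R))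
                                   (is_derive_cst t t (1 : R))).
  by rewrite subr0 [s *: _]mulr1.
rewrite (_ : (fun t => _) = q \o a); last first.
  apply/funext => r; rewrite /q /a /y/=; congr u.
  by rewrite !scalerA addrCA -scalerDl; congr (_ + _ *: _); ring.
apply: is_derive1_comp => //.
by rewrite /a subrr mulr0.
Qed.

(** The increment over a segment is the mean of the derivative along it, and that
    segment stays in K, hence the mean square is averaged over translates that do
    not leave K. *)
Lemma increment_L2 v s j :
  (forall x, K x -> forall t : R, 0 <= t <= 1 -> K (x + v + t *: (s *: 'e_j))) ->
  (\int[mu]_(x in K) ((u (x + v + s *: 'e_j) - u (x + v)) ^+ 2)%:E <=
   (s ^+ 2)%:E * \int[mu]_(x in K) (g j x ^+ 2)%:E)%E.
Proof.
move=> Kseg.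
pose F x : \bar R := ((g j x * s) ^+ 2 * \1_K x)%:E.
have mF : measurable_fun setT F.
  apply/measurable_EFinP; apply: measurable_funM; last exact: measurable_indic.
  by apply: measurable_funX; exact: measurable_funM.
have F0 x : (0 <= F x)%E by rewrite lee_fin mulr_ge0// sqr_ge0.
have -> : ((s ^+ 2)%:E * \int[mu]_(x in K) (g j x ^+ 2)%:E = \int[mu]_x F x)%E.
  rewrite -ge0_integralZl//; last 3 first.
  - apply/measurable_EFinP; apply: measurable_funTS; exact: measurable_funX.
  - by move=> x _; rewrite lee_fin sqr_ge0.
  - by rewrite lee_fin sqr_ge0.
  rewrite integral_mkcond epatch_indic; apply: eq_integral => x _ /=.
  by rewrite /F exprMn -!EFinM; congr EFin; ring.
have := ge0_integral_line v (s *: 'e_j) (measurable_itv `[(0:R), 1]) mF F0.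
rewrite lebesgue_measure_itv/= lte01 sube0 mul1e => <-.
rewrite integral_mkcond.
have msh w : measurable_fun setT (fun x : 'rV[R]_n => u (x + w)).
  exact: (measurableT_comp mu_ (measurable_rV_addr w)).
apply: ge0_le_integral => //.
- by move=> x _; apply: erestrict_ge0 => y _; rewrite lee_fin sqr_ge0.
- apply/(measurable_restrictT _ mK); apply: measurable_funTS.
  apply/measurable_EFinP; apply: measurable_funX; apply: measurable_funB => //.
  by under eq_fun do rewrite -addrA; exact: msh.
- exact: measurable_integral_line.
move=> x _; rewrite patchE; case: ifPn => [|_]; last exact: integral_ge0.
rewrite inE => Kx.
have := @sqr_increment_le R (fun t => u (x + v + t *: (s *: 'e_j)))
  (fun t => g j (x + v + t *: (s *: 'e_j)) * s).
rewrite scale1r scale0r addr0 => /(_ _ _)/le_trans; apply.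
- by move=> t t01; apply: is_derive_line; exact: Kseg.
- move=> t t01; apply: cvgM; last exact: cvg_cst.
  apply: (@continuous_comp _ _ _ (fun t : R => x + v + t *: (s *: 'e_j)) (g j)).
    by apply: cvgD; [exact: cvg_cst|apply: cvgZr_tmp; exact: cvg_id].
  by apply: cg; exact: Kseg.
- rewrite le_eqVlt; apply/orP; left; apply/eqP; apply: eq_integral => t.
  rewrite inE/= in_itv/= => t01.
  by rewrite /F indicE mem_set ?mulr1//; exact: Kseg.
Qed.

(** The corners of the path from 0 to h that follows the coordinate axes in
    order. *)
Definition trunc (h : 'rV[R]_n) (m : nat) : 'rV[R]_n :=
  \row_j (if (j < m)%N then h ord0 j else 0).

Lemma truncS h (j : 'I_n) : trunc h j.+1 = trunc h j + h ord0 j *: 'e_j.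
Proof.
apply/rowP => i; rewrite !mxE eqxx/= ltnS leq_eqVlt.
have [->|ij] := eqVneq i j; first by rewrite eqxx ltnn add0r mulr1.
by rewrite mulr0 addr0; case: eqP => // /val_inj ji; rewrite ji eqxx in ij.
Qed.

(** Cauchy-Schwarz over the n coordinate displacements that make up h. *)
Lemma displacement_L2 (h : 'rV[R]_n) (d : R) :
  (forall j, `|h ord0 j| <= d) ->
  (forall x, K x -> forall (j : 'I_n) (t : R), 0 <= t <= 1 ->
    K (x + trunc h j + t *: (h ord0 j *: 'e_j))) ->
  (\int[mu]_(x in K) ((u (x + h) - u x) ^+ 2)%:E <=
   (n%:R * d ^+ 2)%:E * \sum_j \int[mu]_(x in K) (g j x ^+ 2)%:E)%E.
Proof.
move=> hd Kpath.
pose I (j : 'I_n) (x : 'rV[R]_n) := u (x + trunc h j + h ord0 j *: 'e_j) - u (x + trunc h j).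
have msh w : measurable_fun setT (fun x : 'rV[R]_n => u (x + w)).
  exact: (measurableT_comp mu_ (measurable_rV_addr w)).
have mI j : measurable_fun setT (I j).
  apply: measurable_funB => //.
  by under eq_fun do rewrite -addrA; exact: msh.
have uE (x : 'rV[R]_n) : u (x + h) - u x = \sum_(j < n) I j x.
  pose f m := u (x + trunc h m).
  have -> : \sum_(j < n) I j x = \sum_(0 <= m < n) (f m.+1 - f m).
    by rewrite big_mkord; apply: eq_bigr => j _; rewrite /I /f truncS addrA.
  rewrite telescope_sumr// /f; congr (u _ - u _).
    by congr (_ + _); apply/rowP => j; rewrite mxE ltn_ord.
  by rewrite (_ : trunc h 0 = 0) ?addr0//; apply/rowP => j; rewrite !mxE.
apply: (@le_trans _ _
  (n%:R%:E * \sum_(j < n) \int[mu]_(x in K) (I j x ^+ 2)%:E)%E).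
  rewrite -ge0_integral_sum//; last 2 first.
  - by move=> j; apply/measurable_EFinP/measurable_funTS/measurable_funX.
  - by move=> j x _; rewrite lee_fin sqr_ge0.
  rewrite -ge0_integralZl//; last 2 first.
  - apply: emeasurable_sum => j.
    by apply/measurable_EFinP/measurable_funTS/measurable_funX.
  - by move=> x _; apply: sume_ge0 => j _; rewrite lee_fin sqr_ge0.
  apply: ge0_le_integral => //.
  - by move=> x _; rewrite lee_fin sqr_ge0.
  - apply/measurable_EFinP/measurable_funTS/measurable_funX.
    by apply: measurable_funB => //; exact: msh.
  - apply: measurable_funeM; apply: emeasurable_sum => j.
    by apply/measurable_EFinP/measurable_funTS/measurable_funX.
  - by move=> x _; rewrite sumEFin -EFinM lee_fin uE sqr_sum_le.
rewrite EFinM -muleA lee_wpmul2l ?lee_fin//.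
rewrite ge0_sume_distrr; last first.
  by move=> j _; apply: integral_ge0 => x _; rewrite lee_fin sqr_ge0.
apply: lee_sum => j _.
apply: (@le_trans _ _ ((h ord0 j ^+ 2)%:E * \int[mu]_(x in K) (g j x ^+ 2)%:E)%E).
  apply: increment_L2 => x Kx t t01; exact: Kpath.
apply: lee_wpmul2r.
  by apply: integral_ge0 => x _; rewrite lee_fin sqr_ge0.
by rewrite lee_fin -[leLHS]ger0_norm ?sqr_ge0// normrX lerXn2r// nnegrE// (le_trans _ (hd j)).
Qed.

(** For each x at least half of the points x + h, with h in the box H, avoid Z.
    There u (x + h) vanishes, so that u x is the opposite of an increment, and the
    increments are controlled in the mean square. *)
Lemma poincare_box (l r : 'I_n -> R) (d : R) (Z : set 'rV[R]_n) :
  (forall j, l j < r j) ->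
  measurable Z -> (forall x, ~ Z x -> u x = 0) ->
  (mu Z <= ((\prod_j (r j - l j)) / 2)%:E)%E ->
  (forall h, box l r h -> forall j, `|h ord0 j| <= d) ->
  (forall h, box l r h -> forall x, K x -> forall (j : 'I_n) (t : R), 0 <= t <= 1 ->
    K (x + trunc h j + t *: (h ord0 j *: 'e_j))) ->
  (\int[mu]_(x in K) (u x ^+ 2)%:E <=
   (2 * n%:R * d ^+ 2)%:E * \sum_j \int[mu]_(x in K) (g j x ^+ 2)%:E)%E.
Proof.
move=> lr mZ uZ Zle hd Kpath.
pose H := box l r; pose m := \prod_j (r j - l j).
have m0 : 0 < m by apply: prodr_gt0 => j _; rewrite subr_gt0.
have muH : mu H = m%:E.
  rewrite lebesgue_box; congr EFin; apply: eq_bigr => j _.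
  by rewrite max_r// subr_ge0 ltW.
have mH : measurable H by exact: measurable_box.
set G := (\sum_j _)%E.
pose V (p : 'rV[R]_n * 'rV[R]_n) : \bar R :=
  ((u (p.1 + p.2) - u p.1) ^+ 2 * \1_K p.1 * \1_H p.2)%:E.
have mV : measurable_fun setT V.
  apply/measurable_EFinP; apply: measurable_funM; last first.
    by apply: (measurableT_comp _ measurable_snd); exact: measurable_indic.
  apply: measurable_funM; last first.
    by apply: (measurableT_comp _ measurable_fst); exact: measurable_indic.
  apply: measurable_funX; apply: measurable_funB.
    exact: (measurableT_comp mu_ (@measurable_rV_add R n)).
  exact: (measurableT_comp mu_ measurable_fst).
have V0 p : (0 <= V p)%E by rewrite lee_fin 2?mulr_ge0// sqr_ge0.
have V1 x : K x -> ((u x ^+ 2 * (m / 2))%:E <= \int[mu]_h V (x, h))%E.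
  move=> Kx.
  have [->|ux0] := eqVneq (u x) 0.
    by rewrite expr0n/= mul0r; exact: integral_ge0.
  have mZx : measurable_fun setT (fun h : 'rV[R]_n => \1_Z (h + x) : R).
    by apply: (measurableT_comp _ (measurable_rV_addr x)); exact: measurable_indic.
  have mVx : measurable_fun setT (fun h => V (x, h)).
    exact: (measurableT_comp mV (pair1_measurable x)).
  have mZu : measurable_fun setT
      (fun h : 'rV[R]_n => (u x ^+ 2 * \1_Z (h + x))%:E).
    by apply/measurable_EFinP; exact: measurable_funM.
  have Zu0 (h : 'rV[R]_n) : (0 <= (u x ^+ 2 * \1_Z (h + x))%:E)%E.
    by rewrite lee_fin mulr_ge0// sqr_ge0.
  suff : ((u x ^+ 2 * m)%:E <=
      \int[mu]_h V (x, h) + (u x ^+ 2 * (m / 2))%:E)%E.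
    rewrite -leeBlDr// -EFinB; apply: le_trans.
    by rewrite lee_fin -mulrBr le_eqVlt; apply/orP; left; apply/eqP; field.
  apply: (@le_trans _ _
      (\int[mu]_h (V (x, h) + (u x ^+ 2 * \1_Z (h + x))%:E))%E).
    rewrite EFinM -muH -[X in mu X]setIT -integral_indic//.
    rewrite -ge0_integralZl//; last 2 first.
    - by apply/measurable_EFinP; exact: measurable_indic.
    - by rewrite lee_fin sqr_ge0.
    apply: ge0_le_integral => //.
    - by move=> h _; rewrite mule_ge0// lee_fin sqr_ge0.
    - apply: measurable_funeM; apply/measurable_EFinP; exact: measurable_indic.
    - exact: emeasurable_funD.
    - move=> h _; have [Hh|nHh] := boolP (h \in H); last first.
        by rewrite [in leLHS]indicE (negbTE nHh) mule0 adde_ge0.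
      rewrite /V/= !indicE Hh (mem_set Kx) !mulr1 mule1.
      have [Zh|nZh] := pselect (Z (h + x)).
        by rewrite (mem_set Zh) mulr1 lee_fin lerDr sqr_ge0.
      rewrite (addrC x h) (uZ (h + x))// sub0r sqrrN lee_fin lerDl.
      by rewrite mulr_ge0// sqr_ge0.
  rewrite ge0_integralD//; apply: leeD => //.
  under eq_integral do rewrite EFinM.
  rewrite ge0_integralZl//; last 2 first.
  - exact/measurable_EFinP.
  - by rewrite lee_fin sqr_ge0.
  rewrite (ge0_integral_translate x (f := EFin \o \1_Z)); last 2 first.
  - by apply/measurable_EFinP; exact: measurable_indic.
  - by move=> h; rewrite lee_fin.
  by rewrite integral_indic// setIT [leRHS]EFinM lee_wpmul2l// lee_fin sqr_ge0.
have G0 : (0 <= G)%E.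
  by apply: sume_ge0 => j _; apply: integral_ge0 => x _; rewrite lee_fin sqr_ge0.
have key : ((m / 2)%:E * \int[mu]_(x in K) (u x ^+ 2)%:E <=
            m%:E * ((n%:R * d ^+ 2)%:E * G))%E.
  rewrite -ge0_integralZl//; last 3 first.
  - by apply/measurable_EFinP; apply: measurable_funTS; exact: measurable_funX.
  - by move=> x _; rewrite lee_fin sqr_ge0.
  - by rewrite lee_fin divr_ge0// ltW.
  apply: (@le_trans _ _ (\int[mu]_x \int[mu]_h V (x, h))%E).
    rewrite integral_mkcond; apply: ge0_le_integral => //.
    - move=> x _; apply: erestrict_ge0 => y _.
      by rewrite mule_ge0// lee_fin ?sqr_ge0// divr_ge0// ltW.
    - apply/(measurable_restrictT _ mK); apply: measurable_funeM.
      by apply/measurable_EFinP/measurable_funTS; exact: measurable_funX.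
    - exact: measurable_fun_fubini_tonelli_F.
    - move=> x _; rewrite patchE; case: ifPn => [|_]; last exact: integral_ge0.
      by rewrite inE => Kx; rewrite -EFinM mulrC; exact: V1.
  rewrite fubini_tonelli//.
  apply: (@le_trans _ _ (\int[mu]_h ((\1_H h)%:E * ((n%:R * d ^+ 2)%:E * G)))%E).
    apply: ge0_le_integral => //.
    - by move=> h _; exact: integral_ge0.
    - exact: measurable_fun_fubini_tonelli_G.
    - apply: emeasurable_funM; last exact: measurable_cst.
      by apply/measurable_EFinP; exact: measurable_indic.
    - move=> h _; have [Hh|nHh] := boolP (h \in H); last first.
        rewrite indicE (negbTE nHh) mul0e integral0_eq// => x _.
        by rewrite /V/= !indicE (negbTE nHh) mulr0.
      have {}Hh' := Hh; rewrite inE in Hh'.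
      rewrite indicE Hh mul1e.
      have := @displacement_L2 h d (hd _ Hh') (Kpath _ Hh').
      rewrite integral_mkcond epatch_indic; apply: le_trans.
      rewrite le_eqVlt; apply/orP; left; apply/eqP; apply: eq_integral => x _.
      by rewrite /V/= !indicE Hh mulr1.
  rewrite ge0_integralZr//; last 2 first.
  - by apply/measurable_EFinP; exact: measurable_indic.
  - by rewrite mule_ge0// lee_fin mulr_ge0// sqr_ge0.
  by rewrite integral_indic// setIT [X in (X * _ <= _)%E](_ : _ = m%:E).
rewrite -(@lee_pmul2l _ (m / 2)%:E) ?fin_numE//; last by rewrite lte_fin divr_gt0.
apply: (le_trans key); rewrite !muleA -!EFinM le_eqVlt; apply/orP; left.
by apply/eqP; congr (_%:E * _)%E; field.
Qed.

End poincare.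

(** * Planar sectors and half-planes *)

Section planar_sector.
Variable R : realType.
Implicit Types p q beta : R.

Definition in_polar beta p q := exists rho theta : R,
  [/\ 0 < rho, 0 < theta < beta, p = rho * cos theta & q = rho * sin theta].

Lemma upper_half_polar p q : 0 < q -> in_polar pi p q.
Proof.
move=> q0.
have s0 : 0 < p ^+ 2 + q ^+ 2 by rewrite ltr_wpDl ?sqr_ge0// exprn_gt0.
set rho := Num.sqrt (p ^+ 2 + q ^+ 2).
have rho0 : 0 < rho by rewrite sqrtr_gt0.
have rhoE : rho ^+ 2 = p ^+ 2 + q ^+ 2 by rewrite sqr_sqrtr// ltW.
have prho : `|p / rho| < 1.
  rewrite normrM normfV (gtr0_norm rho0) ltr_pdivrMr// mul1r.
  rewrite -(gtr0_norm rho0) -ltr_sqr ?nnegrE//.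
  by rewrite !real_normK ?num_real// rhoE ltrDl exprn_gt0.
have /andP[pN1 p1] : -1 < p / rho < 1 by rewrite -ltr_norml.
exists rho, (acos (p / rho)); split => //.
- by rewrite acos_gt0 ?acos_ltpi// ?p1 ?pN1 ltW.
- by rewrite acosK ?in_itv/= ?ltW// mulrC divfK// gt_eqF.
- rewrite sin_acos ?ltW//.
  have -> : 1 - (p / rho) ^+ 2 = (q / rho) ^+ 2.
    by rewrite !expr_div_n rhoE; field; rewrite gt_eqF.
  by rewrite sqrtr_sqr ger0_norm ?divr_ge0 ?ltW// mulrC divfK// gt_eqF.
Qed.

Lemma polar_det beta rho theta : sin beta * (rho * cos theta)
  - cos beta * (rho * sin theta) = rho * sin (beta - theta).
Proof. by rewrite sinB; ring. Qed.

(** Below pi both q and the determinant of the point with the second ray have the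
    sign of a sine of an angle in the interval from 0 to pi. *)
Lemma convex_polarP beta p q : 0 < beta < pi ->
  in_polar beta p q <-> 0 < q /\ 0 < sin beta * p - cos beta * q.
Proof.
move=> /andP[b0 bpi]; split=> [[rho [theta [r0 /andP[t0 tb] -> ->]]]|[q0]].
  rewrite polar_det !pmulr_rgt0//; split; apply: sin_gt0_pi.
    by rewrite t0 (lt_trans tb).
  by rewrite subr_gt0 tb/= ltrBlDr (lt_trans bpi)// ltrDl.
have [rho [theta [r0 /andP[t0 tpi] -> ->]]] := upper_half_polar p q0.
rewrite polar_det pmulr_rgt0// => sbt; exists rho, theta; split => //.
rewrite t0/= ltNge; apply/negP => bt.
have : 0 <= sin (theta - beta) by apply: sin_ge0_pi; rewrite subr_ge0 bt/=; lra.
by rewrite -opprB sinN; lra.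
Qed.

(** A point on the positive side of the second ray is brought into the upper
    half-plane by the rotation of angle pi - beta. *)
Lemma reflex_polarP beta p q : pi <= beta < 2 * pi ->
  in_polar beta p q <-> 0 < q \/ 0 < sin beta * p - cos beta * q.
Proof.
move=> /andP[pib b2pi]; split=> [[rho [theta [r0 /andP[t0 tb] -> ->]]]|].
  rewrite polar_det !pmulr_rgt0//.
  have [tpi|pit] := ltP theta pi; first by left; apply: sin_gt0_pi; rewrite t0.
  right; apply: sin_gt0_pi; rewrite subr_gt0 tb/=; lra.
case=> [/(upper_half_polar p)[rho [theta [r0 /andP[t0 tpi] -> ->]]]|pq].
  by exists rho, theta; split => //; rewrite t0 (lt_le_trans tpi).
have := @upper_half_polar (- cos beta * p - sin beta * q) _ pq.
move=> [rho [theta [r0 /andP[t0 tpi] eP eQ]]].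
exists rho, (theta + beta - pi); split => //.
- apply/andP; split; lra.
- transitivity (- (cos beta * (rho * cos theta) - sin beta * (rho * sin theta))).
    rewrite -eP -eQ.
    by rewrite -[LHS]mul1r -(cos2Dsin2 beta); ring.
  have := @cosDpi R (theta + beta - pi); rewrite subrK cosD => E.
  by rewrite -[cos (_ - _)]opprK -E; ring.
- transitivity (- (sin beta * (rho * cos theta) + cos beta * (rho * sin theta))).
    rewrite -eP -eQ.
    by rewrite -[LHS]mul1r -(cos2Dsin2 beta); ring.
  have := @sinDpi R (theta + beta - pi); rewrite subrK sinD => E.
  by rewrite -[sin (_ - _)]opprK -E; ring.
Qed.

(** The opening at distance a of an angle beta is at least a beta / 8: this is the
    source of the linear dependence on beta. *)
Lemma mulr_cos_le_sin beta : 0 < beta < pi -> cos beta * (beta / 8) <= sin beta.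
Proof.
move=> /andP[b0 bpi].
have sb : 0 < sin beta by apply: sin_gt0_pi; rewrite b0.
have [c0|c0] := leP (cos beta) 0.
  by rewrite (le_trans _ (ltW sb))// mulr_le0_ge0// divr_ge0// ltW.
have [c] := @MVT R sin cos 0 beta b0 (fun x _ => is_derive_sin x)
  (continuous_subspaceT (@continuous_sin R)).
rewrite in_itv/= => /andP[c0' cb]; rewrite sin0 !subr0 => ->.
apply: (@le_trans _ _ (cos beta * beta)).
  by rewrite ler_pM2l// ler_pdivrMr// ler_peMr ?ler1n// ltW.
rewrite ler_pM2r// ltW// ltr_cos ?in_itv//= ?ltW//=.
by rewrite (lt_trans cb).
Qed.

End planar_sector.

(** * Test functions extended by zero *)

Section test_functions.
Variables (R : realType) (n : nat).
Local Notation mu := (lebesgue_rV R n).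
Local Notation "''e_' j" := (delta_mx ord0 j : 'rV[R]_n) (at level 8, j at level 2).
Implicit Types (Om Gm K S : set 'rV[R]_n) (phi : 'rV[R]_n -> R).

Lemma smooth_continuous phi : smooth phi -> continuous phi.
Proof. by move=> /(_ [::])[]. Qed.

Lemma smooth_continuous_partial phi j : smooth phi -> continuous (partial j phi).
Proof. by move=> /(_ [:: j])[]. Qed.

Lemma smooth_is_derive phi x j : smooth phi -> is_derive x 'e_j phi (partial j phi x).
Proof. by move=> /(_ [::])[_ /(_ j x)/= d]; split. Qed.

Lemma partial_near0 phi y j : (\forall z \near y, phi z = 0) -> partial j phi y = 0.
Proof.
move=> phi0; rewrite /partial (_ : 'D_'e_j phi y = 'D_'e_j (cst 0) y).
  by rewrite derive_cst.
exact: near_eq_derive.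
Qed.

(** Since K is open in S, no point of K lies on the boundary of S, so none lies on
    Gm; at a point of K outside Om the support condition on a test function then
    leaves a whole neighbourhood free. *)
Lemma test_near0 Om Gm K S phi x : open K -> K `<=` S ->
  Gm `<=` bdry Om `&` bdry S -> H10_test Om Gm phi -> K x -> ~ Om x ->
  \forall y \near x, Om y -> phi y = 0 /\ forall j, partial j phi y = 0.
Proof.
move=> oK KS Gmb [_ _ suppGm] Kx nOmx.
have nGmx : ~ Gm x.
  move=> /Gmb[_ [_]]; apply; apply: filterS KS _.
  by move: oK; rewrite openE; apply.
have [clx|nclx] := pselect (closure Om x); last first.
  have : nbhs x (~` closure Om).
    by apply: open_nbhs_nbhs; split=> //; exact/closed_openC/closed_closure.
  by apply: filterS => y ncl Omy; case: ncl; exact: subset_closure.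
have nsx : ~ supp phi x.
  by move=> sx; have [] := suppGm x (conj sx clx).
have oC : open (~` supp phi) by exact/closed_openC/closed_closure.
have phi0 y : (~` supp phi) y -> phi y = 0.
  move=> nsy; apply/eqP/negPn/negP => py; apply: nsy.
  exact: (@subset_closure _ [set x | phi x != 0]).
apply: filterS (open_nbhs_nbhs (conj oC nsx)) => y nsy _; split; first exact: phi0.
move=> j; apply: partial_near0.
by apply: filterS (open_nbhs_nbhs (conj oC nsy)) => z; exact: phi0.
Qed.

(** The extension of phi by zero is differentiable on K with continuous
    derivatives, and the set where it does not vanish is as small as Om. *)
Lemma poincare_test_cone Om Gm K S phi (l r : 'I_n -> R) (d : R) :
  open Om -> open K -> K `<=` S ->
  Gm `<=` bdry Om `&` bdry S -> H10_test Om Gm phi ->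
  (forall j, l j < r j) ->
  (mu Om <= ((\prod_j (r j - l j)) / 2)%:E)%E ->
  (forall h, box l r h -> forall j, `|h ord0 j| <= d) ->
  (forall h, box l r h -> forall x, K x -> forall (j : 'I_n) (t : R), 0 <= t <= 1 ->
    K (x + trunc h j + t *: (h ord0 j *: 'e_j))) ->
  (\int[mu]_(x in K) ((phi \_ Om) x ^+ 2)%:E <=
   (2 * n%:R * d ^+ 2)%:E * \sum_j \int[mu]_(x in Om) (partial j phi x ^+ 2)%:E)%E.
Proof.
move=> oOm oK KS Gmb tphi lr muOm hd Kpath.
have [[sphi _] _ _] := tphi.
have mOm : measurable Om by exact: open_measurable_rV.
have mK : measurable K by exact: open_measurable_rV.
have mphi : measurable_fun setT phi.
  by apply: continuous_measurable_rV; exact: smooth_continuous.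
have mdphi j : measurable_fun setT (partial j phi).
  by apply: continuous_measurable_rV; exact: smooth_continuous_partial.
have nOm x : Om x -> \forall y \near x, y \in Om.
  move=> Omx; move: oOm; rewrite openE => /(_ _ Omx).
  by apply: filterS => y Omy; rewrite inE.
have mg j : measurable_fun setT (partial j phi \_ Om).
  by apply/(measurable_restrictT _ mOm); exact: measurable_funTS.
apply: (le_trans (@poincare_box R n K (phi \_ Om)
    (fun j => partial j phi \_ Om) mK _ mg _ _ l r d Om lr mOm _ muOm hd Kpath)).
- by apply/(measurable_restrictT _ mOm); exact: measurable_funTS.
- move=> x Kx j; have [Omx|nOmx] := pselect (Om x).
    rewrite patchE mem_set//.
    apply: near_eq_is_derive (smooth_is_derive x j sphi).
    by apply: filterS (nOm _ Omx) => y Omy; rewrite patchE Omy.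
  rewrite patchE memNset//.
  apply: near_eq_is_derive (is_derive_cst (0:R) x 'e_j).
  apply: filterS (test_near0 oK KS Gmb tphi Kx nOmx) => y.
  by rewrite patchE; case: ifPn => //; rewrite inE => Omy /(_ Omy)[->].
- move=> x Kx j; have [Omx|nOmx] := pselect (Om x).
    have := @smooth_continuous_partial phi j sphi x.
    have gx : (partial j phi \_ Om) x = partial j phi x by rewrite patchE mem_set.
    rewrite /prop_for /continuous_at gx.
    apply: cvg_trans; apply: near_eq_cvg; first exact: (nbhs_filter x).
    by apply: filterS (nOm _ Omx) => y Omy; rewrite patchE Omy.
  apply: (near_cst_continuous 0).
  apply: filterS (test_near0 oK KS Gmb tphi Kx nOmx) => y.
  by rewrite patchE; case: ifPn => //; rewrite inE => Omy /(_ Omy)[_ ->].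
- by move=> x nOmx; rewrite patchE memNset.
apply: lee_wpmul2l; first by rewrite lee_fin mulr_ge0 ?sqr_ge0 ?mulr_ge0.
apply: lee_sum => j _.
rewrite [leRHS]integral_mkcond.
apply: (@le_trans _ _ (\int[mu]_x ((partial j phi \_ Om) x ^+ 2)%:E)%E).
  apply: ge0_subset_integral => //.
    by apply/measurable_EFinP; exact: measurable_funX.
  by move=> x _; rewrite lee_fin sqr_ge0.
rewrite le_eqVlt; apply/orP; left; apply/eqP; apply: eq_integral => x _.
by rewrite !patchE; case: ifP => // _; rewrite expr0n.
Qed.

End test_functions.

(** * The Poincare inequality in a sector *)

Section sector_poincare.
Variables (R : realType) (n : nat).
Local Notation mu := (lebesgue_rV R n).
Local Notation "''e_' j" := (delta_mx ord0 j : 'rV[R]_n) (at level 8, j at level 2).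

Definition halfspace (p q : 'I_n) (a b : R) : set 'rV[R]_n :=
  [set x | 0 < a * x ord0 p + b * x ord0 q].

Lemma open_halfspace p q a b : open (halfspace p q a b).
Proof.
have cf : continuous (fun x : 'rV[R]_n => a * x ord0 p + b * x ord0 q).
  move=> x; apply: (@cvgD _ _ _ (nbhs x) (nbhs_filter x)).
    apply: (@cvgM _ _ (nbhs x) (nbhs_filter x)).
      exact: (@cvg_cst _ _ _ (nbhs x) (nbhs_filter x)).
    exact: coord_continuous.
  apply: (@cvgM _ _ (nbhs x) (nbhs_filter x)).
    exact: (@cvg_cst _ _ _ (nbhs x) (nbhs_filter x)).
  exact: coord_continuous.
rewrite (_ : halfspace p q a b =
  (fun x : 'rV[R]_n => a * x ord0 p + b * x ord0 q) @^-1` [set y | 0 < y]) //.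
by move/continuousP: cf; apply; exact: open_gt.
Qed.

Lemma path_coord (x h : 'rV[R]_n) (i j : 'I_n) (t : R) :
  (x + trunc h j + t *: (h ord0 j *: 'e_j)) ord0 i =
  x ord0 i + (if (i < j)%N then 1 else if i == j then t else 0) * h ord0 i.
Proof.
rewrite !mxE eqxx/=; have [->|ij] := eqVneq i j.
  by rewrite ltnn mulr1; ring.
by case: ifP => _; rewrite !mulr0 addr0 ?mul1r ?mul0r.
Qed.

(** Coordinate p moves before coordinate q, so only the corners (h_p, 0) and
    (h_p, h_q) of the path have to be checked. *)
Lemma halfspace_path (p q : 'I_n) (a b : R) (x h : 'rV[R]_n) (j : 'I_n) (t : R) :
  (p < q)%N -> 0 <= t <= 1 ->
  0 <= a * h ord0 p -> 0 <= a * h ord0 p + b * h ord0 q ->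
  halfspace p q a b x ->
  halfspace p q a b (x + trunc h j + t *: (h ord0 j *: 'e_j)).
Proof.
move=> pq /andP[t0 t1] hp hpq; rewrite /halfspace/= !path_coord => x0.
set A := a * h ord0 p in hp hpq *; set B := b * h ord0 q in hpq *.
set tp := if (p < j)%N then _ else _; set tq := if (q < j)%N then _ else _.
rewrite (_ : _ + _ = (a * x ord0 p + b * x ord0 q) + (tp * A + tq * B)); last first.
  by rewrite /A /B; ring.
rewrite ltr_wpDr// /tp /tq.
have [pj|jp] := ltnP p j.
  rewrite mul1r; have [qj|jq] := ltnP q j; first by rewrite mul1r.
  case: eqP => _; last by rewrite mul0r addr0.
  rewrite (_ : A + t * B = (1 - t) * A + t * (A + B)); last by ring.
  by rewrite addr_ge0// mulr_ge0// subr_ge0.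
have jq : (j < q)%N := leq_ltn_trans jp pq.
rewrite ltnNge (ltnW jq)/= (_ : q == j = false); last first.
  by apply/eqP => qj; rewrite qj ltnn in jq.
by rewrite mul0r addr0; case: eqP => _; rewrite ?mul0r// mulr_ge0.
Qed.

Lemma sectorE (p q : 'I_n) beta (x : 'rV[R]_n) : p.+2 = n -> q.+1 = n ->
  sector n beta x <-> in_polar beta (x ord0 p) (x ord0 q).
Proof.
move=> pn qn; split=> [[i [j [i_n jn h]]]|h]; last by exists p, q.
have -> : p = i by apply/val_inj/eqP; rewrite -(eqn_add2r 2) !addn2 pn i_n.
by have -> : q = j by apply/val_inj/eqP; rewrite -(eqn_add2r 1) !addn1 qn jn.
Qed.

Variables (Om Gm : set 'rV[R]_n) (beta a : R) (phi : 'rV[R]_n -> R).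
Hypotheses (n2 : (2 <= n)%N) (a0 : 0 < a) (beta02 : 0 < beta < 2 * pi).
Hypotheses (oOm : open Om) (OmS : Om `<=` sector n beta).
Hypothesis Gmb : Gm `<=` bdry Om `&` bdry (sector n beta).
Hypothesis muOm : (mu Om < (a ^+ n / 16 * beta)%:E)%E.
Hypothesis tphi : H10_test Om Gm phi.

Let D := (\sum_j \int[mu]_(x in Om) (partial j phi x ^+ 2)%:E)%E.

Let D0 : (0 <= D)%E.
Proof. by apply: sume_ge0 => j _; apply: integral_ge0 => x _; rewrite lee_fin sqr_ge0. Qed.

Let mphi2 : measurable_fun setT (fun x => ((phi \_ Om) x ^+ 2)%:E).
Proof.
apply/measurable_EFinP; apply: measurable_funX.
apply/(measurable_restrictT _ (open_measurable_rV oOm)); apply: measurable_funTS.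
by apply: continuous_measurable_rV; apply: smooth_continuous; have [[]] := tphi.
Qed.

(** A convex sector is stable under a box of measure a^n beta / 8 inside it. For
    beta >= pi each of the two half-spaces is stable under a cube of side a, and
    beta < 8 makes a^n / 2 a weaker condition on the measure of Om; adding the two
    inequalities doubles the constant. *)
Lemma poincare_sector :
  (\int[mu]_(x in Om) (phi x ^+ 2)%:E <= (16 * n%:R * a ^+ 2)%:E * D)%E.
Proof.
have /andP[b0 b2pi] := beta02.
have pi4 : pi < 4 :> R by have := @pihalf_lt2 R; lra.
have mOm : measurable Om by exact: open_measurable_rV.
have p_lt : (n - 2 < n)%N by rewrite ltn_subrL (leq_trans _ n2).
have q_lt : (n - 1 < n)%N by rewrite ltn_subrL (leq_trans _ n2).
pose p : 'I_n := Ordinal p_lt; pose q : 'I_n := Ordinal q_lt.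
have pn : p.+2 = n by rewrite /= -addn2 subnK.
have qn : q.+1 = n by rewrite /= -addn1 subnK// ltnW.
have pq : (p < q)%N.
  by have /succn_inj <- : p.+2 = q.+1 by rewrite [RHS]qn [LHS]pn.
have qp : (q == p) = false by apply/eqP => e; rewrite e ltnn in pq.
have SE x := sectorE beta x pn qn.
have OmE K : Om `<=` K -> (\int[mu]_(x in Om) (phi x ^+ 2)%:E =
    \int[mu]_(x in K) ((phi \_ Om) x ^+ 2)%:E)%E.
  move=> OmK; rewrite [LHS]integral_mkcond [RHS]integral_mkcond.
  apply: eq_integral => x _; rewrite !patchE.
  have [xOm|xOm] := boolP (x \in Om); last by rewrite expr0n; case: ifP.
  by rewrite mem_set//; apply: OmK; rewrite inE in xOm.
pose K1 := halfspace p q 0 1.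
pose K2 := halfspace p q (sin beta) (- cos beta).
have K1E x : K1 x <-> 0 < x ord0 q by rewrite /K1 /halfspace/= mul0r add0r mul1r.
have K2E x : K2 x <-> 0 < sin beta * x ord0 p - cos beta * x ord0 q.
  by rewrite /K2 /halfspace/= mulNr.
have [bpi|pib] := ltP beta pi.
- (* a <= h_p and h_q <= a beta / 8 keep the box inside the sector *)
  have SK x : sector n beta x <-> (K1 `&` K2) x.
    have bb : 0 < beta < pi by rewrite b0.
    have CP := convex_polarP (x ord0 p) (x ord0 q) bb.
    by split=> [/SE/CP[/K1E ? /K2E ?]|[/K1E ? /K2E ?]]//; apply/SE/CP.
  pose l (j : 'I_n) := if j == p then a else 0.
  pose r (j : 'I_n) := if j == p then 2 * a else
                       if j == q then a * (beta / 8) else a.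
  have lr j : l j < r j.
    rewrite /l /r; case: eqP => _; first by rewrite ltr_pMl// ltr1n.
    by case: eqP => _ //; rewrite mulr_gt0// divr_gt0.
  have prodlr : \prod_j (r j - l j) = a ^+ n * (beta / 8).
    rewrite (bigD1 q)//= {1}/r {1}/l qp eqxx subr0.
    rewrite (eq_bigr (fun=> a)); last first.
      move=> j jq; rewrite /r /l (negbTE jq); case: ifP => _; last by rewrite subr0.
      by ring.
    rewrite prodr_const (_ : #|_| = n.-1); last by rewrite cardC1 card_ord.
    by rewrite mulrAC -exprS prednK// ltnW.
  have hlr h (j : 'I_n) : box l r h -> 0 <= h ord0 j <= 2 * a.
    move=> /(_ j); rewrite /l /r; case: eqP => _.
      by move=> /andP[? ?]; apply/andP; split; lra.
    case: eqP => _; last by move=> /andP[? ?]; apply/andP; split; lra.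
    move=> /andP[hj0 hj]; rewrite ltW//= (le_trans (ltW hj))//.
    by rewrite mulrC ler_pM2r//; lra.
  rewrite (OmE (K1 `&` K2)); last by move=> x /OmS /SK.
  apply: le_trans (@poincare_test_cone R n Om Gm (K1 `&` K2) (sector n beta) phi
    l r (2 * a) oOm _ _ Gmb tphi lr _ _ _) _.
  + by apply: openI; exact: open_halfspace.
  + by move=> x /SK.
  + by rewrite prodlr (le_trans (ltW muOm))// lee_fin le_eqVlt; apply/orP; left;
      apply/eqP; field.
  + by move=> h bh j; have /andP[? ?] := hlr h j bh; rewrite ger0_norm.
  + move=> h bh x [K1x K2x] j t t01; have /andP[hp0 _] := hlr h p bh.
    have /andP[hq0 _] := hlr h q bh.
    split; apply: halfspace_path => //; first by rewrite mul0r.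
      by rewrite mul0r add0r mul1r.
      by rewrite mulr_ge0// ltW// sin_gt0_pi// b0.
    have := bh p; have := bh q; rewrite /l /r eqxx qp eqxx.
    move=> /andP[_ hq] /andP[hp _].
    have sb := @mulr_cos_le_sin R beta; rewrite b0 bpi in sb; have {}sb := sb isT.
    have s0 : 0 < sin beta by rewrite sin_gt0_pi// b0.
    rewrite mulNr subr_ge0.
    have [c0|c0] := leP (cos beta) 0.
      by rewrite (@le_trans _ _ 0)// ?mulr_le0_ge0// mulr_ge0// ltW.
    apply: (@le_trans _ _ (cos beta * (a * (beta / 8)))).
      by rewrite ler_pM2l// ltW.
    rewrite mulrCA; apply: (@le_trans _ _ (a * sin beta)).
      by rewrite ler_pM2l.
    by rewrite mulrC ler_pM2l// ltW.
  apply: lee_wpmul2r => //; rewrite lee_fin.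
  have : 0 <= n%:R * a ^+ 2 by rewrite mulr_ge0// sqr_ge0.
  by nra.
(* K1 is stable under the positive cube. Since sin beta <= 0, moving p backwards
   never leaves K2; the direction for q is given by the sign of cos beta. *)
have bb : pi <= beta < 2 * pi by rewrite pib.
have RP (x : 'rV[R]_n) := reflex_polarP (x ord0 p) (x ord0 q) bb.
have S1 : K1 `<=` sector n beta by move=> x /K1E ?; apply/SE/RP; left.
have S2 : K2 `<=` sector n beta by move=> x /K2E ?; apply/SE/RP; right.
have muOm2 : (mu Om <= (a ^+ n / 2)%:E)%E.
  rewrite (le_trans (ltW muOm))// lee_fin -!mulrA ler_pM2l ?exprn_gt0//; lra.
have b1 : (\int[mu]_(x in K1) ((phi \_ Om) x ^+ 2)%:E <=
    (2 * n%:R * (2 * a) ^+ 2)%:E * D)%E.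
  apply: (@poincare_test_cone R n Om Gm K1 (sector n beta) phi
    (fun=> 0) (fun=> a) (2 * a) oOm _ S1 Gmb tphi) => //.
  + exact: open_halfspace.
  + by rewrite prodr_const card_ord subr0.
  + move=> h bh j; have /andP[? ?] := bh j.
    by rewrite ger0_norm ?ltW//; lra.
  + move=> h bh x K1x j t t01; have /andP[hp0 _] := bh p.
    have /andP[hq0 _] := bh q.
    apply: halfspace_path => //; first by rewrite mul0r.
    by rewrite mul0r add0r mul1r ltW.
have b2 : (\int[mu]_(x in K2) ((phi \_ Om) x ^+ 2)%:E <=
    (2 * n%:R * (2 * a) ^+ 2)%:E * D)%E.
  pose neg (j : 'I_n) := (j == p) || (j == q) && (0 < cos beta).
  apply: (@poincare_test_cone R n Om Gm K2 (sector n beta) phi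
    (fun j => if neg j then - a else 0) (fun j => if neg j then 0 else a)
    (2 * a) oOm _ S2 Gmb tphi) => //.
  + exact: open_halfspace.
  + by move=> j; case: (neg j) => //; rewrite oppr_lt0.
  + rewrite (eq_bigr (fun=> a)) ?prodr_const ?card_ord//.
    by move=> j _; case: (neg j); rewrite ?subr0// sub0r opprK.
  + move=> h bh j; have := bh j; case: (neg j) => /andP[? ?].
      by rewrite ler_norml; apply/andP; split; lra.
    by rewrite ler_norml; apply/andP; split; lra.
  + move=> h bh x K2x j t t01.
    have sb : sin beta <= 0.
      rewrite -[beta](subrK pi) sinDpi oppr_le0 sin_ge0_pi//.
      by rewrite subr_ge0 pib/=; lra.
    have := bh p; rewrite /neg eqxx/= => /andP[_ hp].
    have hp' : 0 <= sin beta * h ord0 p by rewrite mulr_le0// ltW.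
    apply: halfspace_path => //; rewrite addr_ge0// mulNr oppr_ge0.
    have := bh q; rewrite /neg qp eqxx/=.
    case: (ltP 0 (cos beta)) => c0 /andP[q1 q2].
      by rewrite mulr_ge0_le0// ltW.
    by rewrite mulr_le0_ge0// ltW.
rewrite (OmE (K1 `|` K2)); last first.
  by move=> x /OmS /SE /RP[xq|xpq]; [left; apply/K1E|right; apply/K2E].
apply: (@le_trans _ _ (\int[mu]_(x in K1) ((phi \_ Om) x ^+ 2)%:E +
                       \int[mu]_(x in K2) ((phi \_ Om) x ^+ 2)%:E)%E).
  have mK1 : measurable K1 by apply: open_measurable_rV; exact: open_halfspace.
  have mK2 : measurable K2 by apply: open_measurable_rV; exact: open_halfspace.
  have f0 (E : set 'rV[R]_n) x : E x -> (0 <= ((phi \_ Om) x ^+ 2)%:E)%E.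
    by rewrite lee_fin sqr_ge0.
  have -> : K1 `|` K2 = K1 `|` (K2 `\` K1).
    apply/seteqP; split=> x [K1x|K2x]; [by left| |by left|by right; case: K2x].
    by have [K1x|nK1x] := pselect (K1 x); [left|right].
  rewrite ge0_integral_setU//; last 4 first.
  - exact: measurableD.
  - exact: measurable_funTS.
  - by move=> x _; exact: (f0 setT).
  - by apply/disj_setPS => x [? []].
  apply: leeD => //; apply: ge0_subset_integral => //.
  - exact: measurableD.
  - exact: measurable_funTS.
  - by move=> x _; exact: (f0 setT).
apply: (le_trans (leeD b1 b2)).
have c0 : 0 <= 2 * n%:R * (2 * a) ^+ 2 by rewrite mulr_ge0 ?sqr_ge0 ?mulr_ge0.
rewrite -ge0_muleDl ?lee_fin//.
apply: lee_wpmul2r => //; rewrite -EFinD lee_fin.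
have : 0 <= n%:R * a ^+ 2 by rewrite mulr_ge0// sqr_ge0.
by nra.
Qed.

End sector_poincare.

(** * Smooth bumps on the line *)

Section smooth_functions_of_one_variable.
Variable R : realType.
Implicit Types (f g : R -> R) (k m : nat).

Fixpoint Ck k f : Prop :=
  if k is k'.+1 then (forall t, derivable f t 1) /\ Ck k' (derive1 f) else continuous f.

Definition Coo f := forall k, Ck k f.

Lemma derivable_continuous1 f : (forall t, derivable f t 1) -> continuous f.
Proof. by move=> df t; apply/differentiable_continuous/derivable1_diffP. Qed.

Lemma CkS k f : Ck k.+1 f -> Ck k f.
Proof.
elim: k f => [|k ih] f [df kf]; first exact: derivable_continuous1.
by split=> //; exact: ih.
Qed.

Lemma CkS_is_derive k f f' :
  (forall t : R, is_derive t (1 : R) f (f' t)) -> Ck k f' -> Ck k.+1 f.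
Proof.
move=> df kf'; split; first by move=> t; have [] := df t.
rewrite (_ : (derive1 f) = f')//; apply/funext => t; rewrite derive1E.
by have [_ ->] := df t.
Qed.

Lemma Ck_is_derive k f t : Ck k.+1 f -> is_derive t (1 : R) f ((derive1 f) t).
Proof. by move=> [df _]; split; [exact: df|rewrite derive1E]. Qed.

Lemma Ck_cst k (c : R) : Ck k (cst c).
Proof.
elim: k c => [|k ih] c; first by move=> t; exact: cvg_cst.
apply: (@CkS_is_derive _ _ (cst 0)) => // t; exact: is_derive_cst.
Qed.

Lemma CkD k f g : Ck k f -> Ck k g -> Ck k (fun t => f t + g t).
Proof.
elim: k f g => [|k ih] f g kf kg; first by move=> t; apply: cvgD; [exact: kf|exact: kg].
apply: (@CkS_is_derive _ _ (fun t => (derive1 f) t + (derive1 g) t)).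
  by move=> t; exact: (is_deriveD (Ck_is_derive t kf) (Ck_is_derive t kg)).
by apply: ih; [exact: kf.2|exact: kg.2].
Qed.

Lemma CkM k f g : Ck k f -> Ck k g -> Ck k (fun t => f t * g t).
Proof.
elim: k f g => [|k ih] f g kf kg; first by move=> t; apply: cvgM; [exact: kf|exact: kg].
apply: (@CkS_is_derive _ _ (fun t => f t * (derive1 g) t + g t * (derive1 f) t)).
  by move=> t; exact: (is_deriveM (Ck_is_derive t kf) (Ck_is_derive t kg)).
apply: CkD; apply: ih; by [exact: CkS|exact: kf.2|exact: kg.2].
Qed.

Lemma Ck_affine k f (a b : R) : Ck k f -> Ck k (fun t => f (a * t + b)).
Proof.
have da (t : R) : is_derive t (1 : R) (fun t => a * t + b) a.
  have := is_deriveD (is_deriveZ a (is_derive_id t (1 : R))) (is_derive_cst b t (1 : R)).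
  by rewrite addr0 [a *: _]mulr1.
elim: k f => [|k ih] f kf.
  move=> t; apply: (@continuous_comp _ _ _ (fun t => a * t + b) f).
    by apply/differentiable_continuous/derivable1_diffP; have [] := da t.
  exact: kf.
apply: (@CkS_is_derive k (fun t => f (a * t + b))
  (fun t => (derive1 f) (a * t + b) * a)).
  by move=> t; exact: (is_derive1_comp (da t) (Ck_is_derive (a * t + b) kf)).
by apply: CkM; [exact: (ih _ kf.2)|exact: Ck_cst].
Qed.

(** The derivative of t^-m exp(-1/t) is a combination of two functions of the same
    form, and each of them is flat at 0: hence they are all smooth. *)
Definition flat m (t : R) := if 0 < t then t^-1 ^+ m * expR (- t^-1) else 0.

Lemma flat_ge0 m t : 0 <= flat m t.
Proof.
rewrite /flat; case: ltP => // t0.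
by rewrite mulr_ge0 ?exprn_ge0 ?invr_ge0 ?expR_ge0// ltW.
Qed.

Lemma flat_le m t : flat m.+1 t <= m.+1`!%:R.
Proof.
rewrite /flat; case: ltP => // t0.
have := @expR_ge1Dxn R t^-1 m; rewrite invr_ge0 ltW// => /(_ isT) h.
rewrite expRN ler_pdivrMr ?expR_gt0//.
have : t^-1 ^+ m.+1 / m.+1`!%:R <= expR t^-1 by lra.
by rewrite ler_pdivrMr ?ltr0n ?fact_gt0// mulrC.
Qed.

Lemma is_derive_flat m (t : R) :
  is_derive t (1 : R) (flat m) (- m%:R * flat m.+1 t + flat m.+2 t).
Proof.
have [t0|t0|->] := ltgtP t 0.
- have -> : - m%:R * flat m.+1 t + flat m.+2 t = 0.
    by rewrite /flat ltNge (ltW t0)/= mulr0 addr0.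
  apply: near_eq_is_derive (is_derive_cst (0:R) t (1:R)).
  near=> s; rewrite /flat ltNge ltW//=.
  by near: s; exact: lt_nbhsl.
- pose F (s : R) := s^-1 ^+ m * expR (- s^-1).
  have nearF : \near t, F t = flat m t.
    near=> s; rewrite /flat (_ : 0 < s)//.
    by near: s; exact: lt_nbhsr.
  apply: near_eq_is_derive nearF _.
  have tn0 : t != 0 by rewrite gt_eqF.
  have dV : is_derive t (1 : R) (fun s => s^-1) (- t ^- 2).
    by have := is_deriveV tn0 (is_derive_id t (1:R)); rewrite [_ *: _]mulr1.
  have dX := is_deriveX m dV.
  have dN := is_deriveN dV.
  have dE := is_derive1_comp dN (is_derive_expR (- t^-1)).
  have FE : F = ((fun s : R => s^-1) ^+ m) * (expR \o - (fun s : R => s^-1)).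
    by apply/funext => s; rewrite /F fctE exprfctE.
  rewrite FE; apply: is_derive_eq (is_deriveM dX dE) _.
  rewrite /flat t0 /GRing.scale/= exprfctE -exprVn.
  case: m {dX F FE} => [|m]; rewrite ?mul0r ?expr0 /=; first by ring.
  by rewrite !exprS; ring.
have -> : - m%:R * flat m.+1 0 + flat m.+2 0 = 0.
  by rewrite /flat ltxx mulr0 addr0.
have cv : (fun h : R => h^-1 *: ((flat m \o shift 0) (h *: 1) - flat m 0)) @ 0^' --> (0 : R).
  apply/cvgrPdist_le => e e0; near=> h.
  rewrite sub0r normrN /= addr0 [h *: 1]mulr1 {2}/flat ltxx subr0.
  have [h0|h0] := ltP 0 h; last first.
    by rewrite /flat ltNge h0/= [_ *: _]mulr0 normr0 ltW.
  have -> : h^-1 *: flat m h = h * flat m.+2 h.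
    rewrite /flat h0 /GRing.scale/= !exprS; field.
    by rewrite gt_eqF.
  rewrite ger0_norm; last by rewrite mulr_ge0 ?flat_ge0// ltW.
  apply: (@le_trans _ _ (h * m.+2`!%:R)).
    by rewrite ler_pM2l// flat_le.
  rewrite -ler_pdivlMr ?ltr0n ?fact_gt0//.
  rewrite (le_trans (ler_norm h))//.
  near: h; apply: dnbhs0_le.
  by rewrite divr_gt0 ?ltr0n ?fact_gt0.
split; first by apply/cvg_ex; exists 0.
by apply/cvg_lim.
Unshelve. all: by end_near. Qed.

Lemma Ck_flat k m : Ck k (flat m).
Proof.
elim: k m => [|k ih] m.
  apply: derivable_continuous1 => t; by have [] := is_derive_flat m t.
apply: CkS_is_derive (is_derive_flat m) _.
apply: (CkD (f := fun t => - m%:R * flat m.+1 t)) => //.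
by apply: (CkM (f := cst (- m%:R))) => //; exact: Ck_cst.
Qed.

(** As k grows these smooth functions increase to the indicator of the open
    interval from p to q. *)
Definition bump (p q : R) k (t : R) : R :=
  flat 0 (k.+1%:R * (t - p)) * flat 0 (k.+1%:R * (q - t)).

Lemma Coo_bump p q k : Coo (bump p q k).
Proof.
move=> N; apply: CkM.
- rewrite (_ : (fun t => _) = (fun t => flat 0 (k.+1%:R * t + - k.+1%:R * p))).
    by apply: Ck_affine; exact: Ck_flat.
  by apply/funext => t; congr flat; ring.
- rewrite (_ : (fun t => _) = (fun t => flat 0 (- k.+1%:R * t + k.+1%:R * q))).
    by apply: Ck_affine; exact: Ck_flat.
  by apply/funext => t; congr flat; ring.
Qed.

Lemma flat0_le1 t : flat 0 t <= 1.
Proof.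
rewrite /flat; case: ltP => // t0.
by rewrite expr0 mul1r expR_le1 oppr_le0 invr_ge0 ltW.
Qed.

Lemma bump_ge0 p q k t : 0 <= bump p q k t.
Proof. by rewrite mulr_ge0// flat_ge0. Qed.

Lemma bump_le1 p q k t : bump p q k t <= 1.
Proof. by rewrite mulr_ile1 ?flat_ge0 ?flat0_le1. Qed.

Lemma bump_eq0 p q k t : ~~ (p < t < q) -> bump p q k t = 0.
Proof.
rewrite /bump /flat !pmulr_rgt0 ?ltr0n// !subr_gt0.
by case: ltP => _; case: ltP => _; rewrite ?mul0r ?mulr0.
Qed.

Lemma cvg_flat0 (t : R) : 0 < t -> flat 0 (k.+1%:R * t) @[k --> \oo] --> (1 : R).
Proof.
move=> t0.
rewrite (_ : (fun k => _) = (fun k => expR (- (k.+1%:R^-1 * t^-1)))); last first.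
  by apply/funext => k; rewrite /flat pmulr_rgt0 ?ltr0n// t0 expr0 mul1r invfM.
rewrite -[X in _ --> X](@expR0 R).
apply: continuous_cvg; first exact: continuous_expR.
rewrite -[X in _ --> X]oppr0; apply: cvgN.
rewrite -[X in _ --> X](mul0r t^-1); apply: cvgM; last exact: cvg_cst.
exact: (@cvg_harmonic R).
Qed.

Lemma cvg_bump p q t : bump p q k t @[k --> \oo] --> (\1_(`]p, q[) t : R).
Proof.
have [/andP[pt tq]|ptq] := boolP (p < t < q).
  rewrite indicE mem_set/= ?in_itv/= ?pt//.
  rewrite -[X in _ --> X]mulr1; apply: cvgM; apply: cvg_flat0; by rewrite subr_gt0.
rewrite indicE memNset/=; last by rewrite in_itv/=; exact/negP.
rewrite (_ : (fun k => _) = cst 0); first exact: cvg_cst.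
by apply/funext => k; rewrite bump_eq0.
Qed.

End smooth_functions_of_one_variable.

(** * Product test functions *)

Section mollified_segment.
Variable R : realType.
Variables (p q h : R) (k : nat).
Hypothesis h0 : 0 < h.
Local Notation leb := (@lebesgue_measure R).
Let a := bump p q k.

Let ca : continuous a. Proof. exact: (Coo_bump p q k 0). Qed.

Lemma measurable_bump : measurable_fun setT (a : measurableTypeR R -> measurableTypeR R).
Proof. exact: continuous_measurable_fun. Qed.

Let prim (t : R) : R := (\int[leb]_(s in `]-oo, t]) a s)%R.

Let is_derive_prim t : is_derive t (1 : R) prim (a t).
Proof.
have ia : leb.-integrable `]-oo, t + 1] (EFin \o a).
  apply: (@le_integrable _ _ _ leb _ _ _ (EFin \o \1_(`]p, q[))) => //.
  - apply/measurable_EFinP; apply: measurable_funTS; exact: measurable_bump.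
  - move=> s _ /=; rewrite lee_fin ger0_norm ?bump_ge0// ger0_norm//.
    rewrite indicE; case: (boolP (s \in _)) => sp; first exact: bump_le1.
    rewrite /a bump_eq0//; apply/negP => psq; move/negP: sp; apply.
    by rewrite inE/= in_itv.
  - apply/integrableP; split.
      by apply/measurable_EFinP; exact: measurable_indic.
    under eq_integral do rewrite /= ger0_norm//.
    rewrite integral_indic//.
    apply: (@le_lt_trans _ _ (leb `]p, q[%classic)).
      by apply: le_measure; rewrite ?inE//; exact: measurableI.
    by rewrite lebesgue_measure_oo ltry.
have tt1 : t < t + 1 by rewrite ltrDl.
have [d1 d2] := @continuous_FTC1 R a -oo%O t (t + 1) tt1 ia (ltNyr _) (@ca t).
split; first exact: d1.
by rewrite -(derive1E prim t); exact: d2.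
Qed.

(** The convolution of the bump with the indicator of the segment from 0 to h;
    its derivative is a difference of two bumps. *)
Definition smear (t : R) : R := prim t - prim (t - h).

Lemma is_derive_smear t : is_derive t (1 : R) smear (a t - a (t - h)).
Proof.
have dB : is_derive t (1 : R) (fun t => t - h) 1.
  by have := is_deriveB (is_derive_id t (1:R)) (is_derive_cst h t (1:R)); rewrite subr0.
have := is_derive1_comp dB (is_derive_prim (t - h)); rewrite mulr1 => dC.
exact: (is_deriveB (is_derive_prim t) dC).
Qed.

Lemma Coo_smear : Coo smear.
Proof.
move=> N; apply: CkS; apply: CkS_is_derive is_derive_smear _.
have -> : (fun t => a t - a (t - h)) = (fun t => a t + (-1) * a (1 * t + - h)).
  by apply/funext => t; rewrite mulN1r mul1r.
apply: CkD; first exact: Coo_bump.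
by apply: (CkM (f := cst (-1))); [exact: Ck_cst|apply: Ck_affine; exact: Coo_bump].
Qed.

Lemma smearE t : ((smear t)%:E = \int[leb]_(s in `[0%R, h]) (a (t - s))%:E)%E.
Proof.
have dB s : is_derive s (1 : R) (fun s => t - s) (-1).
  by have := is_deriveB (is_derive_cst t s (1:R)) (is_derive_id s (1:R)); rewrite sub0r.
have dG (s : R) : is_derive s (1 : R) (fun s => - prim (t - s)) (a (t - s)).
  have := is_deriveN (is_derive1_comp (dB s) (is_derive_prim (t - s))).
  by rewrite mulrN1 opprK.
have cG : continuous (fun s => - prim (t - s)).
  by apply: derivable_continuous1 => s; have [] := dG s.
rewrite (@continuous_FTC2 R (fun s => a (t - s)) (fun s => - prim (t - s)) 0 h)//.
- by rewrite -EFinB subr0 /smear; congr EFin; ring.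
- apply: continuous_subspaceT => s.
  apply: (@continuous_comp _ _ _ (fun s => t - s) a); last exact: ca.
  by apply/differentiable_continuous/derivable1_diffP; have [] := dB s.
- split.
  + by move=> s _; have [] := dG s.
  + by apply: cvg_at_right_filter; exact: cG.
  + by apply: cvg_at_left_filter; exact: cG.
- by move=> s _; rewrite derive1E; have [_ ->] := dG s.
Qed.

Lemma smear_eq0 t : ~~ (p <= t <= q + h) -> smear t = 0.
Proof.
move=> tpq; apply: EFin_inj; rewrite smearE integral0_eq// => s /=.
rewrite in_itv/= => /andP[s0 sh]; rewrite /a bump_eq0//.
apply: contra tpq => /andP[? ?]; apply/andP; split; lra.
Qed.

End mollified_segment.

Section product_functions.
Variables (R : realType) (n : nat).
Local Notation "''e_' j" := (delta_mx ord0 j : 'rV[R]_n) (at level 8, j at level 2).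
Implicit Types (c : 'I_n -> R -> R) (x : 'rV[R]_n).

Definition prodfun c x : R := \prod_j c j (x ord0 j).

(** The derivatives of a product of functions of one variable are again such
    products, with one factor replaced. *)
Definition upd c (i : 'I_n) (f : R -> R) (j : 'I_n) := if j == i then f else c j.

Lemma prodfunD1 c i x :
  prodfun c x = c i (x ord0 i) * \prod_(j | j != i) c j (x ord0 j).
Proof. by rewrite /prodfun (bigD1 i). Qed.

Lemma prodfun_upd c i f x :
  prodfun (upd c i f) x = f (x ord0 i) * \prod_(j | j != i) c j (x ord0 j).
Proof.
rewrite (prodfunD1 _ i) /upd eqxx; congr (_ * _).
by apply: eq_bigr => j /negbTE ->.
Qed.

Lemma prodfun_continuous c : (forall j, continuous (c j)) -> continuous (prodfun c).
Proof.
move=> cc; rewrite /prodfun => x.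
elim: (index_enum _) => [|j s ih].
  under eq_fun do rewrite big_nil.
  exact: (@cvg_cst _ _ _ (nbhs x) (nbhs_filter x)).
under eq_fun do rewrite big_cons.
apply: (@cvgM _ _ (nbhs x) (nbhs_filter x)) => //.
apply: (@continuous_comp _ _ _ (fun y : 'rV[R]_n => y ord0 j) (c j)) => //.
  exact: coord_continuous.
exact: cc.
Qed.

Lemma is_derive_prodfun c i x (df : R) :
  is_derive (x ord0 i) (1 : R) (c i) df ->
  is_derive x 'e_i (prodfun c) (df * \prod_(j | j != i) c j (x ord0 j)).
Proof.
move=> dc; set P := \prod_(j | _) _.
pose g (s : R) := P *: c i (s + x ord0 i).
have line : (fun s : R => prodfun c (s *: 'e_i + x)) = g.
  apply/funext => s; rewrite (prodfunD1 _ i) !mxE !eqxx mulr1 /g /GRing.scale/= mulrC.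
  congr (_ * _); apply: eq_bigr => j ji.
  by rewrite !mxE (negbTE ji) mulr0 add0r.
have dg : is_derive (0 : R) (1 : R) g (df * P).
  have dS : is_derive (0 : R) (1 : R) (fun s => s + x ord0 i) 1.
    have := is_deriveD (is_derive_id (0:R) (1:R)) (is_derive_cst (x ord0 i) (0:R) (1:R)).
    by rewrite addr0.
  have dc0 : is_derive (0 + x ord0 i) (1 : R) (c i) df by rewrite add0r.
  have := is_deriveZ P (is_derive1_comp dS dc0).
  by rewrite mulr1 /GRing.scale/= mulrC.
by apply/is_derive_lineP; rewrite line.
Qed.

Lemma partial_prodfun c i : (forall t, derivable (c i) t 1) ->
  partial i (prodfun c) = prodfun (upd c i (derive1 (c i))).
Proof.
move=> dc; apply/funext => x; rewrite prodfun_upd /partial.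
have dci : is_derive (x ord0 i) (1 : R) (c i) (derive1 (c i) (x ord0 i)).
  by split; [exact: dc|rewrite derive1E].
by have [_ ->] := is_derive_prodfun dci.
Qed.

Lemma prodfun_smooth c : (forall j, Coo (c j)) -> smooth (prodfun c).
Proof.
move=> cc s.
have [c' [cc' ->]] : exists c', (forall j, Coo (c' j)) /\
    foldr (@partial R n) (prodfun c) s = prodfun c'.
  elim: s => [|i s [c' [cc' IH]]]; first by exists c.
  exists (upd c' i (derive1 (c' i))); split.
    by move=> j k; rewrite /upd; case: eqP => _; [exact: (cc' i k.+1).2|exact: cc'].
  by rewrite /= IH partial_prodfun// => t; exact: (cc' i 1%N).1.
split; first by apply: prodfun_continuous => j; exact: (cc' j 0%N).
move=> i x.
by have [] := is_derive_prodfun (Ck_is_derive (x ord0 i) (cc' i 1%N)).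
Qed.

Definition cbox (l r : 'I_n -> R) : set 'rV[R]_n :=
  [set x | forall j, l j <= x ord0 j <= r j].

Lemma compact_cbox l r : compact (cbox l r).
Proof.
have := @rV_compact R n (fun j => `[l j, r j]%classic) (fun j => @segment_compact R _ _).
congr compact; apply/seteqP; split=> x h j; have := h j; by rewrite /= in_itv.
Qed.

Lemma closed_cbox l r : closed (cbox l r).
Proof. by apply: compact_closed; [exact: norm_hausdorff|exact: compact_cbox]. Qed.

Lemma prodfun_Cc c l r : (forall j, Coo (c j)) ->
  (forall j t, ~~ (l j <= t <= r j) -> c j t = 0) ->
  Cc_smooth (prodfun c) /\ supp (prodfun c) `<=` cbox l r.
Proof.
move=> cc c0.
have sub : supp (prodfun c) `<=` cbox l r.
  rewrite [X in _ `<=` X]((closure_id _).1 (@closed_cbox l r)).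
  apply: closure_subset => x /= cx j; apply/negPn/negP => xj.
  by move/eqP: cx; apply; rewrite (prodfunD1 c j) c0// mul0r.
split=> //; split; first exact: prodfun_smooth.
apply: subclosed_compact (@compact_cbox l r) sub.
exact: closed_closure.
Qed.

End product_functions.

(** * Weak derivatives tested on smeared bumps *)

Section tonelli_line.
Variables (R : realType) (n : nat).
Local Notation mu := (lebesgue_rV R n).
Local Notation leb := (@lebesgue_measure R).

(** Convolution along a segment is adjoint to convolution along the reversed
    segment. *)
Lemma tonelli_line_dual (D : set R) (v : 'rV[R]_n) (f g : 'rV[R]_n -> \bar R) :
  measurable D -> measurable_fun setT f -> measurable_fun setT g ->
  (forall x, 0 <= f x)%E -> (forall x, 0 <= g x)%E ->
  (\int[mu]_x (g x * \int[leb]_(t in D) f (x + t *: v)%R) =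
   \int[mu]_x (f x * \int[leb]_(t in D) g (x - t *: v)%R))%E.
Proof.
move=> mD mf mg f0 g0.
have mline w : measurable_fun setT
    (fun p : 'rV[R]_n * measurableTypeR R => p.1 + p.2 *: w).
  exact: measurable_rV_line.
have mD2 : measurable_fun setT
    (fun p : 'rV[R]_n * measurableTypeR R => (\1_D p.2 : R)%:E).
  apply/measurable_EFinP; apply: (measurableT_comp _ measurable_snd).
  exact: measurable_indic.
have m1 (f' : 'rV[R]_n -> \bar R) w : measurable_fun setT f' ->
    measurable_fun setT (fun p : 'rV[R]_n * measurableTypeR R => f' (p.1 + p.2 *: w)).
  by move=> mf'; exact: (measurableT_comp mf' (mline w)).
have inner (f' g' : 'rV[R]_n -> \bar R) w : measurable_fun setT f' -> (forall x, 0 <= f' x)%E ->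
    (forall x, 0 <= g' x)%E ->
  (\int[mu]_x (g' x * \int[leb]_(t in D) f' (x + t *: w)%R) =
   \int[mu]_x \int[leb]_t (g' x * f' (x + t *: w)%R * (\1_D t)%:E))%E.
  move=> mf' f'0 g'0; apply: eq_integral => x _.
  rewrite integral_mkcond epatch_indic -ge0_integralZl//.
  - by apply: eq_integral => t _ /=; rewrite muleA.
  - apply: emeasurable_funM; last by apply/measurable_EFinP; exact: measurable_indic.
    exact: (measurableT_comp (m1 _ w mf') (pair1_measurable x)).
  - by move=> t _; rewrite mule_ge0//= lee_fin.
rewrite [LHS](inner f g v mf f0 g0).
under [RHS]eq_integral => x _ do under eq_integral => t _ do rewrite -scalerN.
rewrite [RHS](inner g f (- v) mg g0 f0).
rewrite (@fubini_tonelli _ _ _ _ _ mu leb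
  (fun p => g p.1 * f (p.1 + p.2 *: v)%R * (\1_D p.2)%:E)%E); last 2 first.
- apply: emeasurable_funM => //; apply: emeasurable_funM; last exact: m1.
  exact: (measurableT_comp mg measurable_fst).
- by move=> p; rewrite !mule_ge0.
rewrite (@fubini_tonelli _ _ _ _ _ mu leb
  (fun p => f p.1 * g (p.1 + p.2 *: - v)%R * (\1_D p.2)%:E)%E); last 2 first.
- apply: emeasurable_funM => //; apply: emeasurable_funM; last exact: m1.
  exact: (measurableT_comp mf measurable_fst).
- by move=> p; rewrite !mule_ge0.
apply: eq_integral => t _.
rewrite -[RHS](ge0_integral_translate (t *: v)); last 2 first.
- rewrite /=; apply: emeasurable_funM; last exact: measurable_cst.
  apply: emeasurable_funM => //.
  exact: (measurableT_comp mg (measurable_rV_addr _)).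
- by move=> p; rewrite !mule_ge0.
apply: eq_integral => x _ /=.
by rewrite scalerN addrK; congr (_ * _)%E; exact: muleC.
Qed.

End tonelli_line.

Lemma integrable_funrposneg d (T : measurableType d) (R : realType)
    (mu : {measure set T -> \bar R}) (D : set T) (f : T -> R) :
  measurable D -> mu.-integrable D (EFin \o f) ->
  mu.-integrable D (EFin \o funrpos f) /\ mu.-integrable D (EFin \o funrneg f).
Proof.
move=> mD If; have mf : measurable_fun D f.
  by apply/measurable_EFinP; exact: measurable_int If.
split; apply: le_integrable If => //.
- by apply/measurable_EFinP; exact: measurable_funrpos.
- move=> x _; rewrite lee_fin ger0_norm// /funrpos.
  by rewrite ge_max normr_ge0 ler_norm.
- by apply/measurable_EFinP; exact: measurable_funrneg.
- move=> x _; rewrite lee_fin ger0_norm// /funrneg.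
  by rewrite ge_max normr_ge0 ler_normr lexx orbT.
Qed.

Section line_identity.
Variables (R : realType) (n : nat) (i : 'I_n) (h : R) (l r : 'I_n -> R).
Local Notation mu := (lebesgue_rV R n).
Local Notation leb := (@lebesgue_measure R).
Local Notation e := (delta_mx ord0 i : 'rV[R]_n).
Variables (V W : 'rV[R]_n -> R).
Hypotheses (h0 : 0 < h) (mV : measurable_fun setT V) (mW : measurable_fun setT W).

(** The translates of box l r by s e_i, for s between 0 and h, stay in this set. *)
Definition stretch := cbox l (fun j => r j + (if j == i then h else 0)).
Local Notation C := stretch.

Hypotheses (iV : mu.-integrable C (EFin \o V)) (iW : mu.-integrable C (EFin \o W)).
Hypothesis weak : forall phi, Cc_smooth phi -> supp phi `<=` C ->
  \int[mu]_x (V x * partial i phi x) = - \int[mu]_x (W x * phi x).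

Lemma measurable_stretch : measurable C.
Proof.
by rewrite -(setCK C); apply: measurableC; apply: open_measurable_rV;
  apply: closed_openC; exact: closed_cbox.
Qed.

Lemma integrable_mul_bounded (f psi : 'rV[R]_n -> R) (M : R) :
  measurable_fun setT f -> mu.-integrable C (EFin \o f) ->
  measurable_fun setT psi -> (forall x, C x -> `|psi x| <= M) ->
  (forall x, ~ C x -> psi x = 0) ->
  mu.-integrable setT (EFin \o (fun x => f x * psi x)).
Proof.
move=> mf If mpsi psiM psi0.
have mC := measurable_stretch.
have If' : mu.-integrable setT ((EFin \o f) \_ C) by exact/(integrable_mkcond _ mC).1.
have IMf : mu.-integrable setT (fun x => M%:E * ((EFin \o f) \_ C) x)%E.
  exact: integrableZl.
apply: le_integrable IMf => //.
  by apply/measurable_EFinP; exact: measurable_funM.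
move=> x _ /=; rewrite patchE.
have [xC|xC] := boolP (x \in C); last first.
  have -> : psi x = 0 by apply: psi0 => Cx; move/negP: xC; apply; rewrite inE.
  by rewrite mulr0 normr0 abse_ge0.
rewrite -EFinM lee_fin [leRHS]normrM normrM mulrC ler_wpM2r//.
by rewrite (le_trans (psiM x _)) ?ler_norm//; rewrite inE in xC.
Qed.

Section one_bump.
Variable k : nat.

Let c (j : 'I_n) := bump (l j) (r j) k.
Let b := prodfun c.
Let phi := prodfun (upd c i (smear (l i) (r i) h k)).
Let bh (x : 'rV[R]_n) := b (x - h *: e).

Let b_ge0 x : 0 <= b x.
Proof. by apply: prodr_ge0 => j _; exact: bump_ge0. Qed.

Let b_le1 x : b x <= 1.
Proof.
by apply: prodr_ile1 => j _; rewrite bump_ge0 bump_le1.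
Qed.

Let b0 x : ~ box l r x -> b x = 0.
Proof.
move=> nbx; have [j nj] : exists j, ~~ (l j < x ord0 j < r j).
  by apply/not_existsP => al; apply: nbx => j; apply/negPn/negP; exact: al.
by rewrite /b (prodfunD1 c j) /c bump_eq0// mul0r.
Qed.

Let mb : measurable_fun setT b.
Proof.
apply: continuous_measurable_rV; apply: prodfun_continuous => j.
exact: (Coo_bump _ _ _ 0).
Qed.

Let mbh : measurable_fun setT bh.
Proof. exact: (measurableT_comp mb (measurable_rV_addr _)). Qed.

Let phi_Cc : Cc_smooth phi /\ supp phi `<=` C.
Proof.
apply: prodfun_Cc => j.
  by rewrite /upd; case: eqP => _; [exact: Coo_smear|exact: Coo_bump].
move=> t; rewrite /upd; case: eqP => [->|_]; first exact: smear_eq0.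
rewrite addr0 => tlr; apply: bump_eq0; apply: contra tlr => /andP[? ?].
by rewrite !ltW.
Qed.

Let line_coord (x : 'rV[R]_n) s j :
  (x - s *: e) ord0 j = x ord0 j - (if j == i then s else 0).
Proof. by rewrite !mxE eqxx; case: eqP => _; rewrite ?mulr1 ?mulr0. Qed.

Let b_line x s : b (x - s *: e) =
  bump (l i) (r i) k (x ord0 i - s) * \prod_(j | j != i) c j (x ord0 j).
Proof.
rewrite /b (prodfunD1 c i) line_coord eqxx; congr (_ * _).
by apply: eq_bigr => j /negbTE ji; rewrite line_coord ji subr0.
Qed.

Let phiE x : ((phi x)%:E = \int[leb]_(s in `[0%R, h]) (b (x - s *: e))%:E)%E.
Proof.
rewrite /phi prodfun_upd EFinM smearE//.
under [RHS]eq_integral do rewrite b_line EFinM.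
rewrite ge0_integralZr//.
- apply/measurable_EFinP; apply: measurable_funTS.
  apply: (measurableT_comp (@measurable_bump R _ _ _)).
  by apply: measurable_funB => //; exact: measurable_cst.
- by move=> s _; rewrite lee_fin bump_ge0.
- by rewrite lee_fin; apply: prodr_ge0 => j _; exact: bump_ge0.
Qed.

Let partial_phi x : partial i phi x = b x - bh x.
Proof.
rewrite /phi partial_prodfun; last first.
  by move=> t; rewrite /upd eqxx; have [] := @is_derive_smear R (l i) (r i) h k t.
rewrite prodfun_upd /upd eqxx derive1E.
have [_ ->] := @is_derive_smear R (l i) (r i) h k (x ord0 i).
rewrite (eq_bigr (fun j => c j (x ord0 j))); last by move=> j /negbTE ->.
by rewrite mulrBl /bh b_line /b (prodfunD1 c i).
Qed.

Let phi_ge0 x : 0 <= phi x.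
Proof.
by rewrite -lee_fin phiE integral_ge0// => s _; rewrite lee_fin.
Qed.

Let mphi : measurable_fun setT phi.
Proof.
by apply: continuous_measurable_rV; have [[/(_ [::])[]]] := phi_Cc.
Qed.

Let phi_le x : phi x <= h.
Proof.
rewrite -lee_fin phiE.
have lebh : leb (`[0, h]%classic : set R) = h%:E.
  by rewrite lebesgue_measure_itv/= lte_fin h0 sube0.
have -> : (h%:E = \int[leb]_(s in `[0%R, h]) 1)%E.
  by rewrite integral_cst// mul1e; exact/esym.
apply: ge0_le_integral => //.
- by move=> s _; rewrite lee_fin.
- apply/measurable_EFinP; apply: measurable_funTS.
  apply: (measurableT_comp mb).
  under eq_fun do rewrite -scalerN.
  exact: (measurableT_comp (measurable_rV_line _) (pair1_measurable x)).
- by move=> s _; rewrite lee_fin.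
Qed.

Let outC x : ~ C x -> [/\ b x = 0, bh x = 0 & phi x = 0].
Proof.
move=> nCx; split.
- apply: b0 => bx; apply: nCx => j; have /andP[b1 b2] := bx j.
  rewrite (ltW b1)/=; apply: (le_trans (ltW b2)).
  by case: ifP => _; rewrite ?addr0// lerDl ltW.
- apply: b0 => bx; apply: nCx => j; have := bx j; rewrite line_coord => /andP[b1 b2].
  have hj : 0 <= (if j == i then h else 0) by case: ifP => _ //; exact: ltW.
  move: b1 b2; rewrite ltrBrDr ltrBlDr => b1 b2.
  by rewrite (ltW b2) andbT (le_trans _ (ltW b1))// lerDl.
- apply/eqP/negPn/negP => px; apply: nCx; apply: phi_Cc.2.
  exact: (@subset_closure _ [set x | phi x != 0]).
Qed.

(** With P, Q, S the positive or negative parts of V and W, the identity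
    V(x + h e_i) - V(x) = int_0^h W(x + s e_i) ds becomes an equality of two
    nonnegative quantities of this form, which can be integrated without any
    condition. *)
Definition side (P Q S : 'rV[R]_n -> R) (x : 'rV[R]_n) : \bar R :=
  ((P (x + h *: e))%:E + (Q x)%:E +
   \int[leb]_(s in `[0%R, h]) (S (x + s *: e)%R)%:E)%E.

Lemma integral_side (P Q S : 'rV[R]_n -> R) :
  measurable_fun setT P -> measurable_fun setT Q -> measurable_fun setT S ->
  (forall x, 0 <= P x) -> (forall x, 0 <= Q x) -> (forall x, 0 <= S x) ->
  (\int[mu]_x ((b x)%:E * side P Q S x) =
   \int[mu]_x (P x * bh x)%:E + \int[mu]_x (Q x * b x)%:E
   + \int[mu]_x (S x * phi x)%:E)%E.
Proof.
move=> mP mQ mS P0 Q0 S0.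
have mPh : measurable_fun setT (fun x : 'rV[R]_n => P (x + h *: e)).
  exact: (measurableT_comp mP (measurable_rV_addr _)).
have mI : measurable_fun setT
    (fun x : 'rV[R]_n => \int[leb]_(s in `[0%R, h]) (S (x + s *: e)%R)%:E)%E.
  rewrite (_ : (fun x => _) = (fun x : 'rV[R]_n =>
      \int[leb]_(s in `[0%R, h]) (EFin \o S) (x + 0 + s *: e)%R)%E); last first.
    by apply/funext => x; apply: eq_integral => s _; rewrite addr0.
  apply: measurable_integral_line => //; exact/measurable_EFinP.
have I0 x : (0 <= \int[leb]_(s in `[0%R, h]) (S (x + s *: e)%R)%:E)%E.
  by apply: integral_ge0 => s _; rewrite lee_fin.
have sideE x : ((b x)%:E * side P Q S x = (P (x + h *: e) * b x)%:E + (Q x * b x)%:E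
    + (b x)%:E * \int[leb]_(s in `[0%R, h]) (S (x + s *: e)%R)%:E)%E.
  rewrite /side -EFinD ge0_muleDr//; last by rewrite lee_fin addr_ge0.
  by congr (_ + _)%E; rewrite -EFinM -EFinD mulrC mulrDl.
under eq_integral do rewrite sideE.
rewrite ge0_integralD//; last 4 first.
- by move=> x _; rewrite -EFinD lee_fin addr_ge0// mulr_ge0.
- by apply: emeasurable_funD; apply/measurable_EFinP; exact: measurable_funM.
- by move=> x _; rewrite mule_ge0 ?lee_fin.
- by apply: emeasurable_funM => //; exact/measurable_EFinP.
rewrite ge0_integralD//; last 4 first.
- by move=> x _; rewrite lee_fin mulr_ge0.
- by apply/measurable_EFinP; exact: measurable_funM.
- by move=> x _; rewrite lee_fin mulr_ge0.
- by apply/measurable_EFinP; exact: measurable_funM.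
have -> : (\int[mu]_x (P (x + h *: e) * b x)%:E = \int[mu]_x (P x * bh x)%:E)%E.
  rewrite -(@ge0_integral_translate R n (h *: e) (fun x => (P x * bh x)%:E)).
  - by apply: eq_integral => x _; rewrite /bh addrK.
  - by apply/measurable_EFinP; exact: measurable_funM.
  - by move=> x; rewrite lee_fin mulr_ge0//; exact: b_ge0.
congr (_ + _)%E.
rewrite (@tonelli_line_dual R n `[0%R, h]%classic e (EFin \o S) (EFin \o b)) //;
  [|exact/measurable_EFinP|exact/measurable_EFinP].
by apply: eq_integral => x _; rewrite -phiE EFinM.
Qed.

(** The test function is the bump b averaged along the segment, whose i-th
    derivative is b(x) - b(x - h e_i). Moving the translations from b to V and W
    leaves b as the only weight. *)
Lemma side_bump :
  (\int[mu]_x ((b x)%:E * side (funrpos V) (funrneg V) (funrneg W) x) =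
   \int[mu]_x ((b x)%:E * side (funrneg V) (funrpos V) (funrpos W) x))%E.
Proof.
have mVp : measurable_fun setT (funrpos V) by exact: measurable_funrpos.
have mVn : measurable_fun setT (funrneg V) by exact: measurable_funrneg.
have mWp : measurable_fun setT (funrpos W) by exact: measurable_funrpos.
have mWn : measurable_fun setT (funrneg W) by exact: measurable_funrneg.
rewrite !integral_side//.
have mC := measurable_stretch.
have [iVp iVn] := integrable_funrposneg mC iV.
have [iWp iWn] := integrable_funrposneg mC iW.
have ib (f : 'rV[R]_n -> R) : measurable_fun setT f ->
    mu.-integrable C (EFin \o f) ->
    mu.-integrable setT (EFin \o (fun x => f x * b x)).
  move=> mf If; apply: (@integrable_mul_bounded f b 1) => //.
    by move=> x _; rewrite ger0_norm.
  by move=> x /outC[].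
have ibh (f : 'rV[R]_n -> R) : measurable_fun setT f ->
    mu.-integrable C (EFin \o f) ->
    mu.-integrable setT (EFin \o (fun x => f x * bh x)).
  move=> mf If; apply: (@integrable_mul_bounded f bh 1) => //.
    by move=> x _; rewrite ger0_norm; [exact: b_le1|exact: b_ge0].
  by move=> x /outC[].
have iphi (f : 'rV[R]_n -> R) : measurable_fun setT f ->
    mu.-integrable C (EFin \o f) ->
    mu.-integrable setT (EFin \o (fun x => f x * phi x)).
  move=> mf If; apply: (@integrable_mul_bounded f phi h) => //.
    by move=> x _; rewrite ger0_norm.
  by move=> x /outC[].
have := weak phi_Cc.1 phi_Cc.2.
have split_int (f : 'rV[R]_n -> R) psi :
    mu.-integrable setT (EFin \o (fun x => funrpos f x * psi x)) ->
    mu.-integrable setT (EFin \o (fun x => funrneg f x * psi x)) ->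
    \int[mu]_x (f x * psi x) =
    \int[mu]_x (funrpos f x * psi x) - \int[mu]_x (funrneg f x * psi x).
  move=> i1 i2; rewrite -RintegralB//; apply: eq_Rintegral => x _.
  by rewrite -mulrBl -{1}(funrposBneg f).
rewrite (split_int W phi); [|exact: iphi|exact: iphi].
under eq_Rintegral => x _ do rewrite partial_phi mulrBr.
rewrite RintegralB//; [|exact: ib|exact: ibh].
rewrite (split_int V b); [|exact: ib|exact: ib].
rewrite (split_int V bh); [|exact: ibh|exact: ibh].
have fineI (f : 'rV[R]_n -> R) : mu.-integrable setT (EFin \o f) ->
    (\int[mu]_x (f x)%:E = (\int[mu]_x f x)%:E)%E.
  by move=> If; rewrite /Rintegral fineK//; exact: integrable_fin_num.
rewrite (fineI _ (ibh _ mVp iVp)) (fineI _ (ibh _ mVn iVn)).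
rewrite (fineI _ (ib _ mVp iVp)) (fineI _ (ib _ mVn iVn)).
rewrite (fineI _ (iphi _ mWp iWp)) (fineI _ (iphi _ mWn iWn)).
rewrite -!EFinD => E; congr EFin; move: E.
set a1 := Rintegral _ _ _; set a2 := Rintegral _ _ _; set b1 := Rintegral _ _ _.
set b2 := Rintegral _ _ _; set c1 := Rintegral _ _ _; set c2 := Rintegral _ _ _.
by move: a1 a2 b1 b2 c1 c2 => a1 a2 b1 b2 c1 c2 E; lra.
Qed.

End one_bump.
End line_identity.

(** * Weak derivatives as integrals along segments *)

Section density_uniqueness.
Variables (R : realType) (n : nat).
Local Notation mu := (lebesgue_rV R n).

(** The densities f and g define measures that agree on a pi-system generating the
    Borel sets. *)
Lemma ae_eq_box (l0 r0 : 'I_n -> R) (f g : 'rV[R]_n -> \bar R) :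
  measurable_fun setT f -> measurable_fun setT g ->
  (forall x, 0 <= f x)%E -> (forall x, 0 <= g x)%E ->
  (\int[mu]_(x in box l0 r0) f x < +oo)%E ->
  (forall l r, (forall j, l0 j <= l j)%R -> (forall j, r j <= r0 j)%R ->
    \int[mu]_(x in box l r) f x = \int[mu]_(x in box l r) g x)%E ->
  ae_eq mu (box l0 r0) f g.
Proof.
move=> mf mg f0 g0 foo fg; set B := box l0 r0 in foo *.
have mB : measurable B by exact: measurable_box.
have dens (u : 'rV[R]_n -> \bar R) : measurable_fun setT u -> (forall x, 0 <= u x)%E ->
    exists m : {measure set 'rV[R]_n -> \bar R},
      forall A, m A = (\int[mu]_(x in B `&` A) u x)%E.
  move=> mu' u0.
  pose d (A : set 'rV[R]_n) := (\int[mu]_(x in B `&` A) u x)%E.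
  have d0 : d set0 = 0%E by rewrite /d setI0 integral_set0.
  have dge0 A : (0 <= d A)%E by apply: integral_ge0.
  have dsig : semi_sigma_additive d.
    move=> F mF tF mUF; apply: cvg_toP.
      by apply: is_cvg_nneseries => k _ _; exact: dge0.
    rewrite /d setI_bigcupr ge0_integral_bigcup//.
    - by move=> k; exact: measurableI.
    - exact: measurable_funTS.
    - exact: trivIset_setIl.
  pose m : {measure set 'rV[R]_n -> \bar R} :=
    HB.pack d (isMeasure.Build _ _ _ d d0 dge0 dsig).
  by exists m.
have [mf' mfE] := dens f mf f0; have [mg' mgE] := dens g mg g0.
have E A : measurable A -> mf' A = mg' A.
  apply: (measure_unique [set X | exists l r, X = box l r]
    (fun k => box (fun=> - k%:R) (fun=> k%:R))) => //.
  - exact: sigma_box.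
  - move=> _ _ [l [r ->]] [l' [r' ->]]; rewrite setI_box.
    by do 2!eexists.
  - by move=> k; do 2!eexists.
  - exact: bigcup_box_setT.
  - move=> _ [l [r ->]]; rewrite mfE mgE /B setI_box.
    by apply: fg => j; rewrite ?le_max ?ge_min lexx.
  - move=> k; rewrite mfE; apply: le_lt_trans foo.
    apply: ge0_subset_integral => //; last exact: measurable_funTS.
    by apply: measurableI => //; exact: measurable_box.
apply: integral_ae_eq => //.
- apply/integrableP; split; first exact: measurable_funTS.
  by under eq_integral do rewrite gee0_abs//.
- exact: measurable_funTS.
- move=> A AB mA; have := E A mA; rewrite mfE mgE.
  by rewrite setIidr.
Qed.

End density_uniqueness.

Section line_identity_ae.
Variables (R : realType) (n : nat) (i : 'I_n) (h : R) (l0 r0 : 'I_n -> R).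
Local Notation mu := (lebesgue_rV R n).
Local Notation leb := (@lebesgue_measure R).
Local Notation e := (delta_mx ord0 i : 'rV[R]_n).
Local Notation sd := (side i h).
Hypothesis h0 : 0 < h.

Section side_theory.
Variables P Q S : 'rV[R]_n -> R.
Hypotheses (mP : measurable_fun setT P) (mQ : measurable_fun setT Q).
Hypothesis mS : measurable_fun setT S.
Hypotheses (P0 : forall x, 0 <= P x) (Q0 : forall x, 0 <= Q x).
Hypothesis S0 : forall x, 0 <= S x.

Lemma side_ge0 x : (0 <= sd P Q S x)%E.
Proof.
apply: adde_ge0; first by rewrite -EFinD lee_fin addr_ge0.
by apply: integral_ge0 => s _; rewrite lee_fin.
Qed.

Let mPh : measurable_fun setT (fun x : 'rV[R]_n => (P (x + h *: e))%:E).
Proof. by apply/measurable_EFinP; exact: (measurableT_comp mP (measurable_rV_addr _)). Qed.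

Let mI : measurable_fun setT
  (fun x : 'rV[R]_n => \int[leb]_(s in `[0%R, h]) (S (x + s *: e)%R)%:E)%E.
Proof.
rewrite (_ : (fun x => _) = (fun x : 'rV[R]_n =>
    \int[leb]_(s in `[0%R, h]) (EFin \o S) (x + 0 + s *: e)%R)%E); last first.
  by apply/funext => x; apply: eq_integral => s _; rewrite addr0.
by apply: measurable_integral_line => //; exact/measurable_EFinP.
Qed.

Lemma measurable_side : measurable_fun setT (sd P Q S).
Proof.
apply: emeasurable_funD => //; apply: emeasurable_funD => //.
exact/measurable_EFinP.
Qed.

Lemma integral_sideT :
  (\int[mu]_x sd P Q S x =
   \int[mu]_x (P x)%:E + \int[mu]_x (Q x)%:E + h%:E * \int[mu]_x (S x)%:E)%E.
Proof.
have S0' x : (0 <= (EFin \o S) x)%E by rewrite lee_fin.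
rewrite ge0_integralD//; last 3 first.
- by move=> x _; rewrite adde_ge0 ?lee_fin.
- by apply: emeasurable_funD => //; exact/measurable_EFinP.
- by move=> x _; apply: integral_ge0 => s _; rewrite lee_fin.
rewrite ge0_integralD//; last 3 first.
- by move=> x _; rewrite lee_fin.
- by move=> x _; rewrite lee_fin.
- exact/measurable_EFinP.
rewrite (@ge0_integral_translate R n (h *: e) (EFin \o P))//; [|exact/measurable_EFinP].
congr (_ + _)%E.
have mEFinS : measurable_fun setT (EFin \o S) by exact/measurable_EFinP.
have := ge0_integral_line 0 e (measurable_itv `[0%R, h]) mEFinS S0'.
rewrite lebesgue_measure_itv/= lte_fin h0 sube0 => <-.
by apply: eq_integral => x _; apply: eq_integral => s _; rewrite /= addr0.
Qed.

End side_theory.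

Variables (V W : 'rV[R]_n -> R).
Hypotheses (mV : measurable_fun setT V) (mW : measurable_fun setT W).
Local Notation C := (stretch i h l0 r0).
Local Notation B := (box l0 r0).
Hypotheses (iV : mu.-integrable C (EFin \o V)) (iW : mu.-integrable C (EFin \o W)).
Hypothesis weak : forall phi, Cc_smooth phi -> supp phi `<=` C ->
  \int[mu]_x (V x * partial i phi x) = - \int[mu]_x (W x * phi x).

Let mC : measurable C. Proof. exact: measurable_stretch. Qed.
Let mB : measurable B. Proof. exact: measurable_box. Qed.

Lemma box_line x s : B x -> 0 <= s <= h -> C (x + s *: e).
Proof.
move=> Bx /andP[s0 sh] j; have /andP[b1 b2] := Bx j.
rewrite !mxE eqxx/=; case: eqP => _; rewrite ?mulr1 ?mulr0 ?addr0.
  by rewrite (le_trans (ltW b1)) ?lerDl//= lerD// ltW.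
by rewrite !ltW.
Qed.

Lemma cvg_bump_box (l r : 'I_n -> R) (x : 'rV[R]_n) :
  prodfun (fun j => bump (l j) (r j) k) x @[k --> \oo] --> (\1_(box l r) x : R).
Proof.
have -> : \1_(box l r) x = \prod_j (\1_(`]l j, r j[%classic : set R) (x ord0 j) : R).
  have [bx|nbx] := pselect (box l r x).
    rewrite indicE mem_set// big1// => j _.
    by rewrite indicE mem_set//= in_itv/=; exact: bx.
  have [j nj] : exists j, ~~ (l j < x ord0 j < r j).
    by apply/not_existsP => al; apply: nbx => j; apply/negPn/negP; exact: al.
  rewrite indicE memNset// (bigD1 j)//= indicE memNset ?mul0r//=.
  by rewrite in_itv/=; exact/negP.
rewrite /prodfun; elim: (index_enum _) => [|j s ih].
  under eq_fun do rewrite big_nil.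
  by rewrite big_nil; exact: cvg_cst.
under eq_fun do rewrite big_cons.
by rewrite big_cons; apply: cvgM => //; exact: cvg_bump.
Qed.

Let sideB (P Q S : 'rV[R]_n -> R) : measurable_fun setT P -> measurable_fun setT Q ->
  measurable_fun setT S ->
  (forall x, 0 <= P x) -> (forall x, 0 <= Q x) -> (forall x, 0 <= S x) ->
  mu.-integrable C (EFin \o P) -> mu.-integrable C (EFin \o Q) ->
  mu.-integrable C (EFin \o S) ->
  mu.-integrable B (sd P Q S).
Proof.
move=> mP mQ mS P0 Q0 S0 iP iQ iS; apply/integrableP; split.
  by apply: measurable_funTS; exact: measurable_side.
have res (f : 'rV[R]_n -> R) : measurable_fun setT f -> (forall x, 0 <= f x) ->
    mu.-integrable C (EFin \o f) ->
    [/\ measurable_fun setT (f \_ C), (forall x, 0 <= (f \_ C) x) &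
      (\int[mu]_x ((f \_ C) x)%:E < +oo)%E].
  move=> mf f0 /integrableP[_ If]; split.
  - by apply/(measurable_restrictT _ mC); exact: measurable_funTS.
  - by move=> x; rewrite patchE; case: ifP.
  - apply: le_lt_trans If; rewrite [leRHS]integral_mkcond.
    rewrite le_eqVlt; apply/orP; left; apply/eqP; apply: eq_integral => x _.
    by rewrite !patchE/=; case: ifP => // _; rewrite ger0_norm.
have [mP' P0' oP] := res P mP P0 iP; have [mQ' Q0' oQ] := res Q mQ Q0 iQ.
have [mS' S0' oS] := res S mS S0 iS.
apply: (@le_lt_trans _ _ (\int[mu]_x sd (P \_ C) (Q \_ C) (S \_ C) x)%E).
  rewrite integral_mkcond; apply: ge0_le_integral => //.
  - by move=> x _; apply: erestrict_ge0.
  - apply/(measurable_restrictT _ mB); apply: measurable_funTS.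
    by apply: measurableT_comp => //; exact: measurable_side.
  - exact: measurable_side.
  - move=> x _; rewrite patchE; case: ifPn => [|_]; last exact: side_ge0.
    rewrite inE => Bx; rewrite gee0_abs; last exact: side_ge0.
    rewrite le_eqVlt; apply/orP; left; apply/eqP; rewrite /side.
    have Cx s : 0 <= s <= h -> (x + s *: e) \in C.
      by move=> sh; rewrite inE; exact: box_line.
    congr (_%:E + _%:E + _)%E.
    + by rewrite patchE Cx// lexx ltW.
    + by have := Cx 0; rewrite scale0r addr0 patchE lexx ltW// => ->.
    + apply: eq_integral => s; rewrite inE/= in_itv/= => sh.
      by rewrite patchE Cx.
rewrite integral_sideT//.
rewrite lte_add_pinfty//; first by rewrite lte_add_pinfty.
by rewrite lte_mul_pinfty// lee_fin ltW.
Qed.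

Let L := sd (funrpos V) (funrneg V) (funrneg W).
Let M := sd (funrneg V) (funrpos V) (funrpos W).

Let mVp : measurable_fun setT (funrpos V). Proof. exact: measurable_funrpos. Qed.
Let mVn : measurable_fun setT (funrneg V). Proof. exact: measurable_funrneg. Qed.
Let mWp : measurable_fun setT (funrpos W). Proof. exact: measurable_funrpos. Qed.
Let mWn : measurable_fun setT (funrneg W). Proof. exact: measurable_funrneg. Qed.

Let LB : mu.-integrable B L.
Proof.
have [? ?] := integrable_funrposneg mC iV; have [? ?] := integrable_funrposneg mC iW.
exact: sideB.
Qed.

Let MB : mu.-integrable B M.
Proof.
have [? ?] := integrable_funrposneg mC iV; have [? ?] := integrable_funrposneg mC iW.
exact: sideB.
Qed.

(** Dominated convergence, as the bumps tend to the indicator of the box. *)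
Let bump_cvg (F : 'rV[R]_n -> \bar R) (l r : 'I_n -> R) :
  measurable_fun setT F -> (forall x, 0 <= F x)%E -> mu.-integrable B F ->
  (forall j, l0 j <= l j) -> (forall j, r j <= r0 j) ->
  (\int[mu]_x ((prodfun (fun j => bump (l j) (r j) k) x)%:E * F x) @[k --> \oo]
   --> \int[mu]_(x in box l r) F x)%E.
Proof.
move=> mF F0 iF ll rr; rewrite [X in _ --> X]integral_mkcond epatch_indic.
have sub : box l r `<=` B.
  move=> x bx j; have /andP[b1 b2] := bx j.
  by rewrite (le_lt_trans (ll j) b1) (lt_le_trans b2 (rr j)).
have zero k x : ~ B x -> prodfun (fun j => bump (l j) (r j) k) x = 0.
  move=> nBx; have nbx : ~ box l r x by move=> /sub.
  have [j nj] : exists j, ~~ (l j < x ord0 j < r j).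
    by apply/not_existsP => al; apply: nbx => j; apply/negPn/negP; exact: al.
  by rewrite (prodfunD1 _ j) bump_eq0// mul0r.
have b01 k x : 0 <= prodfun (fun j => bump (l j) (r j) k) x <= 1.
  apply/andP; split; first by apply: prodr_ge0 => j _; exact: bump_ge0.
  by apply: prodr_ile1 => j _; rewrite bump_ge0 bump_le1.
have [] := @dominated_convergence _ _ _ mu setT measurableT
  (fun k x => (prodfun (fun j => bump (l j) (r j) k) x)%:E * F x)%E
  (F \* (EFin \o \1_(box l r)))%E (F \_ B) _ _ _ _ _ => //.
- move=> k; apply: emeasurable_funM => //; apply/measurable_EFinP.
  apply: continuous_measurable_rV; apply: prodfun_continuous => j.
  exact: (Coo_bump _ _ _ 0).
- apply: emeasurable_funM => //; apply/measurable_EFinP.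
  by apply: measurable_indic; exact: measurable_box.
- have := integrable_ae mB iF; apply: filterS => x finF _.
  have [Bx|nBx] := pselect (B x); last first.
    under eq_fun do rewrite zero// mul0e.
    rewrite /= indicE memNset ?mule0; last by move=> /sub.
    exact: cvg_cst.
  rewrite /= -(fineK (finF Bx)).
  under eq_fun do rewrite -EFinM.
  rewrite -EFinM mulrC; apply: cvg_EFin; first exact: nearW.
  by apply: cvgM; [exact: cvg_bump_box|exact: cvg_cst].
- exact/(integrable_mkcond _ mB).1.
- apply: nearW => x k _; rewrite patchE; case: ifPn => [|/negP]; rewrite inE => Bx.
    rewrite gee0_abs ?mule_ge0 ?lee_fin//; last by have /andP[] := b01 k x.
    rewrite -[leRHS]mul1e lee_wpmul2r// lee_fin.
    by have /andP[] := b01 k x.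
  by rewrite zero// mul0e abse0.
Qed.

Let side_eq : ae_eq mu B L M.
Proof.
have mL : measurable_fun setT L by exact: measurable_side.
have mM : measurable_fun setT M by exact: measurable_side.
have L0 x : (0 <= L x)%E by exact: side_ge0.
have M0 x : (0 <= M x)%E by exact: side_ge0.
apply: (ae_eq_box mL mM L0 M0).
  have /integrableP[_] := LB; apply: le_lt_trans.
  by apply: ge0_le_integral => //; [exact: measurable_funTS|
    apply: measurableT_comp => //; exact: measurable_funTS|
    move=> x _; exact: lee_abs].
move=> l r ll rr.
have CC : stretch i h l r `<=` C.
  move=> x Cx j; have /andP[c1 c2] := Cx j.
  by rewrite (le_trans (ll j) c1) (le_trans c2)// lerD.
have mC' : measurable (stretch i h l r) by exact: measurable_stretch.
have key k : (\int[mu]_x ((prodfun (fun j => bump (l j) (r j) k) x)%:E * L x) =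
    \int[mu]_x ((prodfun (fun j => bump (l j) (r j) k) x)%:E * M x))%E :=
  @side_bump R n i h l r V W h0 mV mW
  (integrableS mC mC' CC iV) (integrableS mC mC' CC iW)
  (fun phi Hphi sphi => weak Hphi (subset_trans sphi CC)) k.
have c1 := bump_cvg mL L0 LB ll rr.
have c2 := bump_cvg mM M0 MB ll rr.
have keyE := funext key; rewrite keyE in c1.
exact: (cvg_unique _ c1 c2).
Qed.

(** The two nonnegative sides of the identity have the same integral against every
    bump, hence over every smaller box, and are therefore equal almost everywhere.
    They are finite there, which makes it possible to subtract. *)
Lemma weak_increment : {ae mu, forall x, B x ->
  leb.-integrable `[0, h] (EFin \o (fun s => W (x + s *: e))) /\
  V (x + h *: e) - V x = \int[leb]_(s in `[0, h]) W (x + s *: e)}.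
Proof.
have := side_eq; have := integrable_ae mB MB; have := integrable_ae mB LB.
apply: filterS3 => x Lfin Mfin LM Bx.
have {}Lfin := Lfin Bx; have {}Mfin := Mfin Bx; have {}LM := LM Bx.
have mWx : measurable_fun `[0, h] (fun s : measurableTypeR R => W (x + s *: e)).
  apply: measurable_funTS; apply: (measurableT_comp mW).
  exact: (measurableT_comp (measurable_rV_line _) (pair1_measurable x)).
pose Ip := (\int[leb]_(s in `[0%R, h]) (funrpos W (x + s *: e)%R)%:E)%E.
pose In := (\int[leb]_(s in `[0%R, h]) (funrneg W (x + s *: e)%R)%:E)%E.
have Ip0 : (0 <= Ip)%E by apply: integral_ge0 => s _; rewrite lee_fin.
have In0 : (0 <= In)%E by apply: integral_ge0 => s _; rewrite lee_fin.
have Ipfin : Ip \is a fin_num.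
  by move: Mfin; rewrite /M /side -/Ip -EFinD fin_numD => /andP[].
have Infin : In \is a fin_num.
  by move: Lfin; rewrite /L /side -/In -EFinD fin_numD => /andP[].
have mWpx : measurable_fun `[0, h] (fun s : measurableTypeR R => funrpos W (x + s *: e)).
  exact: (measurable_funrpos mWx).
have mWnx : measurable_fun `[0, h] (fun s : measurableTypeR R => funrneg W (x + s *: e)).
  exact: (measurable_funrneg mWx).
have iWp : leb.-integrable `[0, h] (EFin \o (fun s => funrpos W (x + s *: e))).
  apply/integrableP; split; first exact/measurable_EFinP.
  under eq_integral do rewrite /= ger0_norm//.
  by rewrite -/Ip ltey_eq Ipfin.
have iWn : leb.-integrable `[0, h] (EFin \o (fun s => funrneg W (x + s *: e))).
  apply/integrableP; split; first exact/measurable_EFinP.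
  under eq_integral do rewrite /= ger0_norm//.
  by rewrite -/In ltey_eq Infin.
have WE : (fun s => W (x + s *: e)) =
    (fun s => funrpos W (x + s *: e) - funrneg W (x + s *: e)).
  by apply/funext => s; rewrite -{1}(funrposBneg W).
have mI : measurable (`[0, h]%classic : set (measurableTypeR R)) := measurable_itv _.
split; first by rewrite WE; exact: (integrableB mI iWp iWn).
rewrite WE RintegralB// /Rintegral -/Ip -/In.
move: LM; rewrite /L /M /side -/Ip -/In -(fineK Ipfin) -(fineK Infin) -!EFinD.
move=> -[LM]; rewrite -{1 2}(funrposBneg V) !fctE/=; lra.
Qed.

End line_identity_ae.

(** * Lebesgue points on lines *)

Lemma integrable_sqr_bounded d (T : measurableType d) (R : realType)
    (mu : {measure set T -> \bar R}) (C : set T) (f : T -> R) :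
  measurable C -> (mu C < +oo)%E -> measurable_fun C f ->
  (\int[mu]_(x in C) (f x ^+ 2)%:E < +oo)%E -> mu.-integrable C (EFin \o f).
Proof.
move=> mC Coo mf f2; apply/integrableP; split; first exact/measurable_EFinP.
have mf2 : measurable_fun C (fun x => (f x ^+ 2)%:E).
  by apply/measurable_EFinP; exact: measurable_funX.
apply: (@le_lt_trans _ _ (\int[mu]_(x in C) (1 + (f x ^+ 2)%:E))%E).
  apply: ge0_le_integral => //.
  - by apply: measurableT_comp => //; exact/measurable_EFinP.
  - by apply: emeasurable_funD => //; exact: measurable_cst.
  - move=> t _ /=; rewrite -EFinD lee_fin -subr_ge0 -(real_normK (num_real (f t))).
    have := sqr_ge0 (`|f t| - 2^-1); nra.
rewrite ge0_integralD//; last by move=> t _; rewrite lee_fin sqr_ge0.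
by rewrite integral_cst// mul1e lte_add_pinfty.
Qed.

Section lebesgue_points.
Variable R : realType.
Local Notation leb := (@lebesgue_measure R).

Lemma lebesgue_measure_translate (a : R) (A : set (measurableTypeR R)) :
  measurable A -> leb ((fun x => x + a) @^-1` A) = leb A.
Proof.
move=> mA; apply/esym.
have ma : measurable_fun setT (fun x : measurableTypeR R => x + a : measurableTypeR R).
  by apply: measurable_funD => //; exact: measurable_cst.
pose nu : {measure set (measurableTypeR R) -> \bar R} :=
  measure_function_pushforward__canonical__measure_function_Measure leb ma.
change (leb A = nu A); apply: lebesgue_measure_unique => // _ [[u v] _ <-] /=.
rewrite /nu/= /pushforward (_ : _ @^-1` _ = `]u - a, v - a]%classic).
  rewrite !lebesgue_measure_itv/= !lte_fin ltrD2r; case: ifP => // _.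
  by rewrite -!EFinB; congr EFin; ring.
by apply/seteqP; split=> x /=; rewrite !in_itv/= ltrBlDr lerBrDr.
Qed.

Lemma ge0_integral_translate1 (a h : R) (F : R -> \bar R) :
  measurable_fun setT (F : measurableTypeR R -> \bar R) -> (forall x, 0 <= F x)%E ->
  (\int[leb]_(t in `[0%R, h]) F (t + a)%R = \int[leb]_(t in `[a, (a + h)%R]) F t)%E.
Proof.
move=> mF F0.
have ma : measurable_fun setT (fun x : measurableTypeR R => x + a : measurableTypeR R).
  by apply: measurable_funD => //; exact: measurable_cst.
have mD : measurable (`[a, (a + h)%R]%classic : set (measurableTypeR R)).
  exact: measurable_itv.
have := ge0_integral_pushforward ma leb mD
  (measurable_funTS mF) (fun x _ => F0 x).
rewrite (_ : _ @^-1` _ = `[0, h]%classic); last first.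
  apply/seteqP; split=> x /=; rewrite !in_itv/= => /andP[? ?]; apply/andP; split; lra.
move=> <-.
apply: (eq_measure_integral leb (m1 :=
  measure_function_pushforward__canonical__measure_function_Measure leb ma)) => A mA _.
exact: lebesgue_measure_translate.
Qed.

(** The segment from s to s + 1/(k+1) is a fixed proportion of a ball centred
    at s, so the one-sided means are controlled by the centred ones. *)
Lemma lebesgue_pt_right (f : R -> R) (s : R) :
  measurable_fun setT (f : measurableTypeR R -> measurableTypeR R) ->
  lebesgue_pt f s ->
  ((k.+1%:R)%:E * \int[leb]_(t in `[0%R, (k.+1%:R^-1)%R]) `|f (t + s)%R - f s|%:E)%E
    @[k --> \oo] --> (0 : \bar R)%E.
Proof.
move=> mf lpt.
have r0 k : (0 : R) < 2 * k.+1%:R^-1 by rewrite mulr_gt0// invr_gt0 ltr0n.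
have r_cvg : (fun k => 2 * k.+1%:R^-1 : R) @ \oo --> (0 : R)^'+.
  have rc : (fun k => 2 * k.+1%:R^-1 : R) @ \oo --> (0 : R).
    rewrite -[X in _ --> X](mulr0 2); apply: cvgM; first exact: cvg_cst.
    exact: (@cvg_harmonic R).
  move=> A [e /= e0 eA]; move/cvgrPdist_lt : rc => /(_ _ e0)[N _ rN].
  by exists N => // k Nk; apply: eA => //=; exact: rN.
have dcvg := cvg_comp _ _ r_cvg lpt.
have d4 : (4%:E * davg f s (2 * k.+1%:R^-1)%R)%E @[k --> \oo] --> (0 : \bar R)%E.
  by rewrite -[X in _ --> X](mule0 4%:E); apply: cvgeZl.
apply: (squeeze_cvge _ (cvg_cst _) d4); apply: nearW => k; apply/andP; split.
  by rewrite mule_ge0// ?lee_fin// integral_ge0.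
have mfs : measurable_fun setT (fun t : measurableTypeR R => `|f t - f s|%:E).
  apply/measurable_EFinP; apply: measurableT_comp => //.
  by apply: measurable_funB => //; exact: measurable_cst.
rewrite (@ge0_integral_translate1 s _ (fun t => `|f t - f s|%:E))//.
rewrite /davg /iavg lebesgue_measure_ball; last exact: ltW.
have -> : (2 * k.+1%:R^-1 *+ 2 : R) = 4 / k.+1%:R by rewrite -mulr_natr; ring.
rewrite muleA inver mulf_eq0 invr_eq0 !pnatr_eq0/= -EFinM invf_div mulrCA divff// mulr1.
apply: lee_wpmul2l; first by rewrite lee_fin.
apply: ge0_subset_integral => //.
- exact: measurable_ball.
- exact: measurable_funTS.
- move=> t /=; rewrite in_itv/= => /andP[st ts].
  rewrite /ball/= distrC ger0_norm ?subr_ge0//.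
  have k0 : (0 : R) < k.+1%:R^-1 by rewrite invr_gt0 ltr0n.
  by move: (k.+1%:R^-1 : R) k0 ts => d k0 ts; lra.
Qed.

End lebesgue_points.

Section lebesgue_points_on_lines.
Variables (R : realType) (n : nat) (v : 'rV[R]_n) (W : 'rV[R]_n -> R).
Local Notation mu := (lebesgue_rV R n).
Local Notation leb := (@lebesgue_measure R).
Hypothesis mW : measurable_fun setT W.
Hypothesis W2 : (\int[mu]_x (W x ^+ 2)%:E < +oo)%E.

(** The mean of |W - W y| over the segment from y to y + v/(k+1). *)
Definition line_osc k (y : 'rV[R]_n) : \bar R :=
  ((k.+1%:R)%:E * \int[leb]_(t in `[0%R, (k.+1%:R^-1)%R]) `|W (y + t *: v)%R - W y|%:E)%E.

Let osc_ge0 k y : (0 <= line_osc k y)%E.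
Proof. by rewrite /line_osc mule_ge0// ?lee_fin// integral_ge0. Qed.

Let mosc k : measurable_fun setT (line_osc k).
Proof.
apply: measurable_funeM.
pose H (p : 'rV[R]_n * measurableTypeR R) : \bar R :=
  (`|W (p.1 + p.2 *: v)%R - W p.1| * \1_(`[0, k.+1%:R^-1]%classic : set R) p.2)%:E.
rewrite (_ : (fun y => _) = fubini_F leb H).
  apply: measurable_fun_fubini_tonelli_F; last first.
    by move=> p; rewrite lee_fin mulr_ge0.
  apply/measurable_EFinP; apply: measurable_funM; last first.
    by apply: (measurableT_comp _ measurable_snd); exact: measurable_indic.
  apply: measurableT_comp => //; apply: measurable_funB.
    exact: (measurableT_comp mW (measurable_rV_line v)).
  exact: (measurableT_comp mW measurable_fst).
apply/funext => y; rewrite /fubini_F [LHS]integral_mkcond epatch_indic.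
by apply: eq_integral => t _; rewrite /H EFinM.
Qed.

Let A := [set y | limn_esup (line_osc^~ y) != 0%E].

Let mA : measurable A.
Proof.
rewrite -[A]setTI; apply: emeasurable_neq => //.
exact: measurable_fun_limn_esup.
Qed.

Let nA y : ~ A y -> line_osc k y @[k --> \oo] --> (0 : \bar R)%E.
Proof.
move/negP/negPn/eqP => ly; apply: limn_esup_le_cvg; first by rewrite ly.
by move=> k; exact: osc_ge0.
Qed.

(** On the line through x, W is locally square integrable, and the differentiation
    theorem applies; the interval from -1 to 2 is a neighbourhood of the one where
    the conclusion is needed. *)
Let good_line x : (\int[leb]_(t in `[(-1)%R, 2%R]) (W (x + t *: v)%R ^+ 2)%:E < +oo)%E ->
  (\int[leb]_(t in `[0%R, 1%R]) (\1_A (x + t *: v)%R)%:E = 0)%E.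
Proof.
move=> fin; pose f (t : R) := W (x + t *: v); pose D : set R := `[(-1)%R, 2%R]%classic.
have mD : measurable (D : set (measurableTypeR R)) by exact: measurable_itv.
have mline : measurable_fun setT (fun t : measurableTypeR R => x + t *: v).
  exact: (measurableT_comp (measurable_rV_line v) (pair1_measurable x)).
have mf : measurable_fun setT (f : measurableTypeR R -> measurableTypeR R).
  exact: (measurableT_comp mW mline).
have fD : leb.-integrable D (EFin \o f).
  have Dfin : (leb D < +oo)%E.
    by rewrite lebesgue_measure_itv/= lte_fin; case: ifP => _ //; rewrite -EFinB ltry.
  by apply: integrable_sqr_bounded => //; exact: measurable_funTS.
have := lebesgue_differentiation (integrable_locally_restrict mD fD).
move=> ae_pt; rewrite (ae_eq_integral (cst 0%E))//.
- by rewrite integral0.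
- apply/measurable_EFinP; apply: measurable_funTS.
  by apply: (measurableT_comp _ mline); exact: measurable_indic.
- apply: (@filterS _ _ (ae_filter_ringOfSetsType leb) _ _ _ ae_pt) => s pt.
  rewrite /= in_itv/= => /andP[s0 s1].
  rewrite indicE memNset//= => /negP; apply; apply/eqP.
  have mf1 : measurable_fun setT (f \_ D : measurableTypeR R -> measurableTypeR R).
    by apply/(measurable_restrictT _ mD); exact: measurable_funTS.
  have := lebesgue_pt_right mf1 pt.
  move/cvg_limn_einf_sup => [_ <-]; congr limn_esup; apply/funext => k.
  congr (_ * _)%E; apply: eq_integral => t; rewrite inE/= in_itv/= => /andP[t0 tk].
  have {tk} t1 : t <= 1.
    by apply: (le_trans tk); rewrite invf_le1 ?ltr0n// ler1n.
  have sD : s \in D by rewrite inE /D/= in_itv/=; apply/andP; split; lra.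
  have tsD : t + s \in D by rewrite inE /D/= in_itv/=; apply/andP; split; lra.
  by rewrite !patchE sD tsD /f -addrA -scalerDl (addrC s t).
Qed.

(** The bad set meets almost every line of direction v in a null set, and it is
    null because its measure is the integral of the lengths of its intersections
    with unit segments of these lines. *)
Lemma ae_lebesgue_line : {ae mu, forall y, line_osc k y @[k --> \oo] --> (0 : \bar R)%E}.
Proof.
exists A; split => //; last first.
  by move=> y /= ny; apply/not_notP => nAy; apply: ny; exact: nA.
have mW2 : measurable_fun setT (fun x => (W x ^+ 2)%:E).
  by apply/measurable_EFinP; exact: measurable_funX.
have m1A : measurable_fun setT (fun x : 'rV[R]_n => (\1_A x : R)%:E).
  by apply/measurable_EFinP; exact: measurable_indic.
have fin : {ae mu, forall x,
    (\int[leb]_(t in `[(-1)%R, 2%R]) (W (x + 0 + t *: v)%R ^+ 2)%:E < +oo)%E}.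
  pose J (x : 'rV[R]_n) := (\int[leb]_(t in `[(-1)%R, 2%R]) (W (x + 0 + t *: v)%R ^+ 2)%:E)%E.
  have J0 x : (0 <= J x)%E by apply: integral_ge0 => t _; rewrite lee_fin sqr_ge0.
  have iJ : mu.-integrable setT J.
    apply/integrableP; split.
      apply: (@measurable_integral_line R n _ 0 v (fun x => (W x ^+ 2)%:E)) => //.
      by move=> x; rewrite lee_fin sqr_ge0.
    under eq_integral do rewrite gee0_abs//.
    rewrite (@ge0_integral_line R n _ 0 v (fun x => (W x ^+ 2)%:E))//; last first.
      by move=> x; rewrite lee_fin sqr_ge0.
    rewrite lebesgue_measure_itv/= lte_fin; case: ifP => _; last by rewrite mul0e.
    by rewrite -EFinB lte_mul_pinfty// lee_fin; lra.
  have := integrable_ae measurableT iJ; apply: filterS => x /(_ I) Jfin.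
  by rewrite ltey_eq Jfin.
have := @ge0_integral_line R n `[0%R, 1%R]%classic 0 v (fun x => (\1_A x : R)%:E)
  (measurable_itv _) m1A (fun x => _).
rewrite integral_indic// setIT lebesgue_measure_itv/= lte_fin ltr01 sube0 mul1e => <-.
  rewrite (@ge0_ae_eq_integral _ _ _ mu setT _ (cst 0%E))//.
  - by rewrite integral0.
  - apply: (@measurable_integral_line R n `[0%R, 1%R]%classic 0 v
      (fun x => (\1_A x : R)%:E)) => // x; by rewrite lee_fin.
  - by move=> x _; apply: integral_ge0 => t _; rewrite lee_fin.
  - apply: filterS fin => x finx _.
    exact: (good_line finx).
by move=> x; rewrite lee_fin.
Qed.

End lebesgue_points_on_lines.

(** * Difference quotients of Sobolev functions *)

Lemma ae_forall_countable d (T : measurableType d) (R : realType)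
    (mu : {measure set T -> \bar R}) (I : countType) (P : I -> T -> Prop) :
  (forall i, {ae mu, forall x, P i x}) -> {ae mu, forall x, forall i, P i x}.
Proof.
move=> aeP.
have : {ae mu, forall x, forall k, (if unpickle k is Some i then P i x else True)}.
  by apply: ae_foralln => k; case: unpickle => [i|]; [exact: aeP|exact: nearW].
by apply: filterS => x Px i; have := Px (pickle i); rewrite pickleK.
Qed.

Section difference_quotients.
Variables (R : realType) (n : nat).
Local Notation mu := (lebesgue_rV R n).
Local Notation leb := (@lebesgue_measure R).

Lemma Lp2_measurable (Om : set 'rV[R]_n) (u : 'rV[R]_n -> R) :
  Lp Om 2%:E u -> measurable_fun setT (u \_ Om).
Proof. by rewrite /Lp inE => /andP[+ _]; rewrite inE. Qed.

Lemma Lp2_sqr (Om : set 'rV[R]_n) (u : 'rV[R]_n -> R) :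
  Lp Om 2%:E u -> (\int[mu]_x ((u \_ Om) x ^+ 2)%:E < +oo)%E.
Proof.
move=> /Lfun2_integrable_sqr/integrableP[_]; apply: le_lt_trans.
rewrite le_eqVlt; apply/orP; left; apply/eqP; apply: eq_integral => x _ /=.
by rewrite ger0_norm// sqr_ge0.
Qed.

Variables (Om : set 'rV[R]_n) (u : 'rV[R]_n -> R) (Du : 'I_n -> 'rV[R]_n -> R).
Hypotheses (oOm : open Om) (Wu : W12 Om u Du).

Lemma W12_setT phi i : Cc_smooth phi -> supp phi `<=` Om ->
  \int[mu]_x ((u \_ Om) x * partial i phi x) =
  - \int[mu]_x ((Du i \_ Om) x * phi x).
Proof.
move=> Cphi sphi; have [_ _ /(_ phi Cphi sphi i)] := Wu.
rewrite [in X in X -> _]Rintegral_mkcond [in X in - X]Rintegral_mkcond.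
have E (f g : 'rV[R]_n -> R) : (fun x => f x * g x) \_ Om = (fun x => (f \_ Om) x * g x).
  by apply/funext => x; rewrite !patchE; case: ifP => // _; rewrite mul0r.
by rewrite !E.
Qed.

(** Countably many pairs of a rational cube and an increment suffice, so one null
    set serves them all. *)
Lemma W12_increment i : {ae mu, forall x, Om x -> exists N, forall k, (N <= k)%N ->
  let h := k.+1%:R^-1 : R in
  leb.-integrable `[0, h]
    (EFin \o (fun s => (Du i \_ Om) (x + s *: (delta_mx ord0 i : 'rV[R]_n)))) /\
  (u \_ Om) (x + h *: (delta_mx ord0 i : 'rV[R]_n)) - (u \_ Om) x =
   \int[leb]_(s in `[0, h]) (Du i \_ Om) (x + s *: (delta_mx ord0 i : 'rV[R]_n))}.
Proof.
have [Lu LDu _] := Wu.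
have key (p : 'rV[rat]_n * nat * nat) : {ae mu, forall x,
    cube p.1.1 p.1.2 2 `<=` Om -> (p.1.2 < p.2)%N -> cube p.1.1 p.1.2 1 x ->
    let h := p.2.+1%:R^-1 : R in
    leb.-integrable `[0, h]
      (EFin \o (fun s => (Du i \_ Om) (x + s *: (delta_mx ord0 i : 'rV[R]_n)))) /\
    (u \_ Om) (x + h *: (delta_mx ord0 i : 'rV[R]_n)) - (u \_ Om) x =
     \int[leb]_(s in `[0, h]) (Du i \_ Om) (x + s *: (delta_mx ord0 i : 'rV[R]_n))}.
  case: p => [[q m] k] /=.
  have [qOm|nqOm] := pselect (cube q m 2 `<=` Om); last first.
    by apply: nearW => x /nqOm.
  have [mk|km] := boolP (m < k)%N; last by apply: nearW => x _.
  set h : R := k.+1%:R^-1.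
  have h0 : 0 < h by rewrite invr_gt0 ltr0n.
  have hm : h < m.+1%:R^-1 by rewrite ltf_pV2 ?posrE ?ltr0n// ltr_nat ltnS.
  pose l (j : 'I_n) : R := ratr (q ord0 j) - 1 / m.+1%:R.
  pose r (j : 'I_n) : R := ratr (q ord0 j) + 1 / m.+1%:R.
  have CC : stretch i h l r `<=` cube q m 2.
    rewrite /l /r; move=> x Cx j; have /andP[] := Cx j.
    have hj : 0 <= (if j == i then h else 0) <= h by case: ifP; rewrite ?lexx ltW.
    have m0 : 0 < m.+1%:R^-1 :> R by rewrite invr_gt0 ltr0n.
    move: hm hj m0; move: (m.+1%:R^-1 : R) (if _ then _ else _) (x ord0 j) (ratr _ : R).
    move=> d e y z; clearbody h => hd /andP[e0 eh] d0 y1 y2.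
    by apply/andP; split; lra.
  have mV := Lp2_measurable Lu; have mW := Lp2_measurable (LDu i).
  have mC := measurable_stretch i h l r.
  have Coo : (mu (stretch i h l r) < +oo)%E.
    apply: (@le_lt_trans _ _ (mu (cube q m 2))).
      by apply: le_measure; rewrite ?inE//; exact: measurable_box.
    by rewrite lebesgue_box ltry.
  have iC (f : 'rV[R]_n -> R) : measurable_fun setT f ->
      (\int[mu]_x (f x ^+ 2)%:E < +oo)%E ->
      mu.-integrable (stretch i h l r) (EFin \o f).
    move=> mf f2; apply: integrable_sqr_bounded => //; first exact: measurable_funTS.
    apply: le_lt_trans f2; apply: ge0_subset_integral => //.
      by apply/measurable_EFinP; exact: measurable_funX.
    by move=> x _; rewrite lee_fin sqr_ge0.
  have := @weak_increment R n i h l r h0 _ _ mV mW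
    (iC _ mV (Lp2_sqr Lu)) (iC _ mW (Lp2_sqr (LDu i)))
    (fun phi Cphi sphi => W12_setT i Cphi (subset_trans sphi (subset_trans CC qOm))).
  by apply: filterS => x inc _ _ cx; exact: inc.
have := ae_forall_countable key; apply: filterS => x all_p Omx.
have [q [m [cx qOm]]] := open_cube oOm Omx.
by exists m.+1 => k mk; exact: (all_p ((q, m), k)).
Qed.

(** The difference quotient is the mean of the weak derivative over the segment,
    and these means converge at the Lebesgue points on the line. *)
Lemma W12_difference_quotient i : {ae mu, forall x, Om x ->
  k.+1%:R * ((u \_ Om) (x + k.+1%:R^-1 *: (delta_mx ord0 i : 'rV[R]_n)) - (u \_ Om) x)
    @[k --> \oo] --> Du i x}.
Proof.
have [Lu LDu _] := Wu.
have mW := Lp2_measurable (LDu i).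
have := ae_lebesgue_line (delta_mx ord0 i) mW (Lp2_sqr (LDu i)).
have := W12_increment i; apply: filterS2 => x inc osc Omx.
have [N Ninc] := inc Omx.
have WE : (Du i \_ Om) x = Du i x by rewrite patchE mem_set.
rewrite -WE; apply/cvgrPdist_le => eps eps0.
move/fine_cvgP : osc => [_ /cvgrPdist_le/(_ _ eps0)[M _ oscM]].
exists (maxn N M) => // k; rewrite /= geq_max => /andP[Nk Mk].
have [intW incW] := Ninc k Nk.
set h : R := k.+1%:R^-1 in intW incW *; set v := delta_mx ord0 i in intW incW *.
have h0 : 0 < h by rewrite invr_gt0 ltr0n.
have mI : measurable (`[0, h]%classic : set (measurableTypeR R)) := measurable_itv _.
have lebI : leb (`[0, h]%classic : set R) = h%:E.
  by rewrite lebesgue_measure_itv/= lte_fin h0 sube0.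
have icst : leb.-integrable `[0, h] (EFin \o cst ((Du i \_ Om) x)).
  apply/integrableP; split; first by apply/measurable_EFinP; exact: measurable_cst.
  rewrite (_ : (\int[leb]_(t in _) _ = (`|(Du i \_ Om) x|%R)%:E * leb `[0%R, h]%classic)%E).
    by rewrite lebI -EFinM ltry.
  by rewrite -(integral_cst leb mI); apply: eq_integral => t _.
have iB := integrableB mI intW icst.
have -> : (Du i \_ Om) x - k.+1%:R * ((u \_ Om) (x + h *: v) - (u \_ Om) x) =
    - (k.+1%:R * \int[leb]_(s in `[0, h]) ((Du i \_ Om) (x + s *: v) - (Du i \_ Om) x)).
  rewrite incW RintegralB// Rintegral_cst//.
  rewrite (_ : fine _ = h); last by rewrite -[RHS]/(fine h%:E) -lebI.
  rewrite mulrBr opprB; congr (_ - _).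
  by rewrite mulrCA /h divff ?mulr1.
rewrite normrN normrM ger0_norm//.
have := oscM k Mk; rewrite /= sub0r normrN; apply: le_trans.
apply: (le_trans _ (ler_norm _)).
apply: (@le_trans _ _ (k.+1%:R * \int[leb]_(s in `[0, h])
    `|(Du i \_ Om) (x + s *: v) - (Du i \_ Om) x|)).
  by rewrite ler_wpM2l// le_normr_Rintegral.
rewrite /line_osc fineM//.
rewrite ge0_fin_numE; last by apply: integral_ge0.
by have /integrableP[_] := iB.
Qed.

End difference_quotients.

(** * The gradient of the positive part and the closure of test functions *)

Lemma funrpos_increment (R : realType) (a b : R) :
  (Num.max a 0 - Num.max b 0) * ((Num.max a 0 - Num.max b 0) - (a - b)) <= 0.
Proof. by case: (leP a 0) => ha; case: (leP b 0) => hb; nra. Qed.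

Section positive_part.
Variables (R : realType) (n : nat) (Om : set 'rV[R]_n).
Local Notation mu := (lebesgue_rV R n).
Variables (w : 'rV[R]_n -> R) (Dw Dwp : 'I_n -> 'rV[R]_n -> R).
Hypotheses (oOm : open Om) (Ww : W12 Om w Dw) (Wwp : W12 Om (funrpos w) Dwp).

(** The gradients of the positive and the negative part of w never point the same
    way, because the increments of the two parts have opposite signs. *)
Lemma gradient_funrpos i :
  {ae mu, forall x, Om x -> Dwp i x ^+ 2 <= Dw i x * Dwp i x}.
Proof.
have := W12_difference_quotient oOm Ww i.
have := W12_difference_quotient oOm Wwp i.
apply: filterS2 => x qp q Omx; have {}qp := qp Omx; have {}q := q Omx.
set e := delta_mx ord0 i in qp q.
have posE y : (funrpos w \_ Om) y = Num.max ((w \_ Om) y) 0.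
  by rewrite !patchE; case: ifP => // _; rewrite maxxx.
set a := (fun k => k.+1%:R * _) in qp; set b := (fun k => k.+1%:R * _) in q.
have ab : (fun k => a k * (a k - b k)) @ \oo --> Dwp i x * (Dwp i x - Dw i x).
  by apply: cvgM => //; exact: cvgB.
suff : Dwp i x * (Dwp i x - Dw i x) <= 0 by rewrite mulrBr subr_le0 expr2 (mulrC (Dw i x)).
rewrite -(cvg_lim (@Rhausdorff R) ab); apply: limr_le.
  by apply/cvg_ex; exists (Dwp i x * (Dwp i x - Dw i x)).
apply: nearW => k; rewrite /a /b -mulrBr mulrACA.
rewrite pmulr_rle0; last by rewrite mulr_gt0 ?ltr0n.
by rewrite !posE funrpos_increment.
Qed.

End positive_part.

Section H10_poincare.
Variables (R : realType) (n : nat) (Om Gm : set 'rV[R]_n) (C : R).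
Local Notation mu := (lebesgue_rV R n).
Hypotheses (oOm : open Om) (C0 : 0 <= C).
Hypothesis test_poincare : forall phi, H10_test Om Gm phi ->
  (\int[mu]_(x in Om) (phi x ^+ 2)%:E <=
   C%:E * \sum_j \int[mu]_(x in Om) (partial j phi x ^+ 2)%:E)%E.

Let mOm : measurable Om. Proof. exact: open_measurable_rV. Qed.

Lemma Lp_measurable p (u : 'rV[R]_n -> R) : Lp Om p u -> measurable_fun Om u.
Proof.
by rewrite /Lp inE => /andP[+ _]; rewrite inE/= => /(measurable_restrictT _ mOm).2.
Qed.

Lemma Lp2_sqr_lty (u : 'rV[R]_n -> R) :
  Lp Om 2%:E u -> (\int[mu]_(x in Om) (u x ^+ 2)%:E < +oo)%E.
Proof.
move=> /Lp2_sqr; apply: le_lt_trans; rewrite integral_mkcond.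
rewrite le_eqVlt; apply/orP; left; apply/eqP; apply: eq_integral => x _.
by rewrite !patchE; case: ifP => // _; rewrite expr0n.
Qed.

Lemma W12_norm_lt (u : 'rV[R]_n -> R) Du (eps : R) : 0 < eps ->
  (W12_norm Om u Du < eps%:E)%E ->
  (\int[mu]_(x in Om) (u x ^+ 2 + \sum_i Du i x ^+ 2)%:E <= (eps ^+ 2)%:E)%E.
Proof.
rewrite /W12_norm => eps0; set A := (\int[mu]_(x in Om) _)%E.
have A0 : (0 <= A)%E.
  apply: integral_ge0 => x _; rewrite lee_fin addr_ge0 ?sqr_ge0//.
  by apply: sumr_ge0 => i _; exact: sqr_ge0.
case: A A0 => [r| |]//; last by rewrite poweRyr ?invr_eq0.
rewrite poweR_EFin lee_fin lte_fin => r0; rewrite powR12_sqrt// => sr.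
rewrite lee_fin -(sqr_sqrtr r0) ltW// ltr_sqr ?nnegrE ?sqrtr_ge0//; exact: ltW.
Qed.

(** Passing to the closure uses (f + g)^2 <= 2 f^2 + 2 g^2 twice, once for the
    functions and once for their gradients. *)
Lemma poincare_H10 u Du : H10 Om Gm u Du ->
  (\int[mu]_(x in Om) (u x ^+ 2)%:E <=
   (4 * C)%:E * \sum_j \int[mu]_(x in Om) (Du j x ^+ 2)%:E)%E.
Proof.
move=> [[Lu LDu _] app].
have mu_ : measurable_fun Om u := Lp_measurable Lu.
have mDu j : measurable_fun Om (Du j) := Lp_measurable (LDu j).
have sq (f : 'rV[R]_n -> R) : measurable_fun Om f ->
    measurable_fun Om (fun x => (f x ^+ 2)%:E).
  by move=> mf; apply/measurable_EFinP; exact: measurable_funX.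
have sq0 (f : 'rV[R]_n -> R) x : (0 <= (f x ^+ 2)%:E)%E by rewrite lee_fin sqr_ge0.
have dbl (f g : 'rV[R]_n -> R) : measurable_fun Om f -> measurable_fun Om g ->
    (\int[mu]_(x in Om) (f x ^+ 2)%:E <= 2%:E * \int[mu]_(x in Om) ((f x - g x) ^+ 2)%:E
       + 2%:E * \int[mu]_(x in Om) (g x ^+ 2)%:E)%E.
  move=> mf mg.
  have mfg : measurable_fun Om (fun x => ((f x - g x) ^+ 2)%:E).
    by apply: (sq (fun x => f x - g x)); exact: measurable_funB.
  have mg2 := sq _ mg.
  rewrite -(ge0_integralZl mu mOm mfg) ?lee_fin//; last first.
    by move=> x _; exact: (sq0 (fun x => f x - g x)).
  rewrite -(ge0_integralZl mu mOm mg2) ?lee_fin//.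
  rewrite -ge0_integralD//; last 4 first.
  - by move=> x _; rewrite mule_ge0 ?lee_fin// sqr_ge0.
  - exact: measurable_funeM.
  - by move=> x _; rewrite mule_ge0 ?lee_fin// sqr_ge0.
  - exact: measurable_funeM.
  apply: ge0_le_integral => //.
  - exact: sq.
  - by apply: emeasurable_funD; exact: measurable_funeM.
  - move=> x _; rewrite -!EFinM -EFinD lee_fin -subr_ge0.
    by rewrite (_ : _ - _ = (f x - 2 * g x) ^+ 2) ?sqr_ge0//; ring.
set E := (\sum_j \int[mu]_(x in Om) (Du j x ^+ 2)%:E)%E.
apply/lee_addgt0Pr => d d0.
pose K := 2 + 4 * C.
have K0 : 0 < K by rewrite ltr_wpDr// mulr_ge0.
pose eps := Num.sqrt (d / K).
have eps0 : 0 < eps by rewrite sqrtr_gt0 divr_gt0.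
have [phi tphi /(W12_norm_lt eps0)] := app _ eps0.
rewrite sqr_sqrtr; last by rewrite divr_ge0// ltW.
move=> close.
have [[sphi _] _ _] := tphi.
have mphi : measurable_fun Om phi.
  by apply: measurable_funTS; apply: continuous_measurable_rV; exact: smooth_continuous.
have mdphi j : measurable_fun Om (partial j phi).
  apply: measurable_funTS; apply: continuous_measurable_rV.
  exact: smooth_continuous_partial.
pose X := (\int[mu]_(x in Om) ((u x - phi x) ^+ 2)%:E)%E.
pose Y := (\sum_j \int[mu]_(x in Om) ((Du j x - partial j phi x) ^+ 2)%:E)%E.
have X0 : (0 <= X)%E by apply: integral_ge0 => x _; exact: (sq0 (fun x => u x - phi x)).
have Y0 : (0 <= Y)%E.
  apply: sume_ge0 => j _; apply: integral_ge0 => x _.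
  exact: (sq0 (fun x => Du j x - partial j phi x)).
have XY : (X + Y <= (d / K)%:E)%E.
  apply: le_trans close; rewrite /X /Y -ge0_integral_sum//; last 2 first.
  - by move=> j; apply: (sq (fun x => Du j x - partial j phi x)); exact: measurable_funB.
  - by move=> j x _; exact: (sq0 (fun x => Du j x - partial j phi x)).
  rewrite -ge0_integralD//.
  - by under eq_integral do rewrite sumEFin -EFinD.
  - by move=> x _; exact: (sq0 (fun x => u x - phi x)).
  - by apply: (sq (fun x => u x - phi x)); exact: measurable_funB.
  - move=> x _; apply: sume_ge0 => j _.
    exact: (sq0 (fun x => Du j x - partial j phi x)).
  - apply: emeasurable_sum => j.
    by apply: (sq (fun x => Du j x - partial j phi x)); exact: measurable_funB.
have E0 : (0 <= E)%E by apply: sume_ge0 => j _; apply: integral_ge0.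
have Efin : E \is a fin_num.
  by apply/sum_fin_numP => j _ _; rewrite ge0_fin_numE ?integral_ge0// Lp2_sqr_lty.
have Xle : (X <= (d / K)%:E)%E by apply: le_trans XY; exact: leeDl.
have Yle : (Y <= (d / K)%:E)%E by apply: le_trans XY; exact: leeDr.
have Phi2 : (\sum_j \int[mu]_(x in Om) (partial j phi x ^+ 2)%:E <=
    2%:E * Y + 2%:E * E)%E.
  rewrite !ge0_sume_distrr//; last 2 first.
  - by move=> j _; apply: integral_ge0.
  - move=> j _; apply: integral_ge0 => x _.
    exact: (sq0 (fun x => Du j x - partial j phi x)).
  rewrite -big_split/=; apply: lee_sum => j _.
  apply: (le_trans (dbl _ _ (mdphi j) (mDu j))); apply: leeD => //.
  apply: lee_wpmul2l; first by rewrite lee_fin.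
  rewrite le_eqVlt; apply/orP; left; apply/eqP; apply: eq_integral => x _.
  by rewrite -sqrrN opprB.
apply: (le_trans (dbl u phi mu_ mphi)); rewrite -/X.
have tp := test_poincare tphi.
have [e Ee] : exists e, E = e%:E by exists (fine E); rewrite fineK.
rewrite Ee in Phi2 *.
have dK : K * (d / K) = d by rewrite mulrC divfK// gt_eqF.
set t := d / K in Xle Yle dK.
have P3 : (\sum_j \int[mu]_(x in Om) (partial j phi x ^+ 2)%:E <= (2 * t + 2 * e)%:E)%E.
  apply: (le_trans Phi2); rewrite [leRHS]EFinD.
  by apply: leeD; rewrite ?[leRHS]EFinM// lee_wpmul2l// lee_fin.
have P4 : (\int[mu]_(x in Om) (phi x ^+ 2)%:E <= (C * (2 * t + 2 * e))%:E)%E.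
  by apply: (le_trans tp); rewrite EFinM lee_wpmul2l// lee_fin.
apply: (@le_trans _ _ (2%:E * t%:E + 2%:E * (C * (2 * t + 2 * e))%:E)%E).
  by apply: leeD; rewrite lee_wpmul2l// lee_fin.
rewrite -!EFinM -!EFinD lee_fin -[leRHS]/(4 * C * e + d) -dK /K.
by rewrite le_eqVlt; apply/orP; left; apply/eqP; ring.
Qed.

End H10_poincare.

(** * The energy estimate *)

Section energy.
Variables (R : realType) (n : nat).
Local Notation mu := (lebesgue_rV R n).

Lemma lebesgue_setT_gt0 : (0 < mu [set: 'rV[R]_n])%E.
Proof.
apply: (@lt_le_trans _ _ (mu (box (fun=> 0) (fun=> 1)))).
  rewrite lebesgue_box lte_fin; apply: prodr_gt0 => j _.
  by rewrite subr0 max_r// ler01.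
by apply: le_measure; rewrite ?inE//; exact: measurable_box.
Qed.

Lemma ae_lt_of_Lnormy (Om : set 'rV[R]_n) (c : 'rV[R]_n -> R) (c0 : R) :
  ('N[mu]_+oo [EFin \o (funrpos c \_ Om)%R] < c0%:E)%E ->
  {ae mu, forall x, Om x -> c x <= c0}.
Proof.
rewrite unlock /Lnorm lebesgue_setT_gt0 => Nc.
have := ess_sup_ge mu (abse \o (EFin \o (funrpos c \_ Om)%R)).
apply: filterS => x cx Omx; rewrite -lee_fin.
apply: le_trans (ltW Nc); apply: le_trans cx.
rewrite /= patchE mem_set// ger0_norm ?funrpos_ge0// lee_fin.
by rewrite /funrpos le_max lexx.
Qed.

(** An infinite integral of f is read as 0, and then the sign of g gives the
    conclusion. *)
Lemma le_Rintegral_ae (Om : set 'rV[R]_n) (f g : 'rV[R]_n -> R) :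
  measurable Om -> measurable_fun Om f -> mu.-integrable Om (EFin \o g) ->
  {ae mu, forall x, Om x -> 0 <= g x /\ f x <= g x} ->
  \int[mu]_(x in Om) f x <= \int[mu]_(x in Om) g x.
Proof.
move=> mOm mf ig fg.
have mg : measurable_fun Om g by apply/measurable_EFinP; exact: measurable_int ig.
have gE : (\int[mu]_(x in Om) (g x)%:E = \int[mu]_(x in Om) (funrpos g x)%:E)%E.
  apply: ae_eq_integral => //.
  - exact/measurable_EFinP.
  - by apply/measurable_EFinP; exact: measurable_funrpos.
  - apply: filterS fg => x fgx Omx; have [g0 _] := fgx Omx.
    by rewrite /funrpos max_l.
have le : (\int[mu]_(x in Om) (f x)%:E <= \int[mu]_(x in Om) (g x)%:E)%E.
  apply: (@le_trans _ _ (\int[mu]_(x in Om) (funrpos f x)%:E)%E).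
    rewrite integralE; apply: (@le_trans _ _ (\int[mu]_(x in Om) ((EFin \o f)^\+%E x))%E).
      by rewrite geeDl// oppe_le0; apply: integral_ge0.
    rewrite le_eqVlt; apply/orP; left; apply/eqP; apply: eq_integral => x _.
    by rewrite funeposE /funrpos /= EFin_max.
  rewrite gE; apply: ae_ge0_le_integral => //.
  - by move=> x _; rewrite lee_fin funrpos_ge0.
  - by apply/measurable_EFinP; exact: measurable_funrpos.
  - by move=> x _; rewrite lee_fin funrpos_ge0.
  - by apply/measurable_EFinP; exact: measurable_funrpos.
  - apply: filterS fg => x fgx Omx; have [g0 fgx'] := fgx Omx.
    by rewrite lee_fin /funrpos (max_l g0) ge_max fgx'.
have gfin : (\int[mu]_(x in Om) (g x)%:E)%E \is a fin_num by exact: integrable_fin_num.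
rewrite /Rintegral; case: (boolP ((\int[mu]_(x in Om) (f x)%:E)%E \is a fin_num)) => ffin.
  exact: fine_le.
have -> : fine (\int[mu]_(x in Om) (f x)%:E)%E = 0.
  by move: ffin; case: (integral _ _ _).
by rewrite gE fine_ge0// integral_ge0// => x _; rewrite lee_fin funrpos_ge0.
Qed.

Lemma integrable_Lp2_mul (Om : set 'rV[R]_n) (u v : 'rV[R]_n -> R) : open Om ->
  Lp Om 2%:E u -> Lp Om 2%:E v -> mu.-integrable Om (EFin \o (u \* v)).
Proof.
move=> /open_measurable_rV mOm Lu Lv.
have /Lfun1_integrable := Lfun2_mul_Lfun1 Lu Lv.
rewrite (integrable_mkcond (EFin \o (u \* v)) mOm).
congr (_.-integrable _ _); apply/funext => x /=.
by rewrite !patchE; case: ifP => // _; rewrite mulr0.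
Qed.

Lemma ae_eq0_sqr (Om : set 'rV[R]_n) (u : 'rV[R]_n -> R) : measurable Om ->
  measurable_fun Om u -> (\int[mu]_(x in Om) (u x ^+ 2)%:E = 0)%E ->
  {ae mu, forall x, Om x -> u x = 0}.
Proof.
move=> mOm mu_ u0.
have m2 : measurable_fun Om (fun x => (u x ^+ 2)%:E).
  by apply/measurable_EFinP; exact: measurable_funX.
have [h _] := ae_eq_integral_abs mu mOm m2.
have {}h : ae_eq mu Om (fun x => (u x ^+ 2)%:E) (cst 0%E).
  apply: h; rewrite -[RHS]u0; apply: eq_integral => x _.
  by rewrite gee0_abs// lee_fin sqr_ge0.
by apply: filterS h => x hx /hx[/eqP]; rewrite sqrf_eq0 => /eqP.
Qed.

End energy.

Theorem lemma2p5 (R : realType) (n : nat) (c0 : R) :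
  (2 <= n)%N -> 0 < c0 ->
  exists2 eta : R, 0 < eta &
  forall (beta : R) (Om G1 : set 'rV[R]_n) (c w : 'rV[R]_n -> R)
         (Dw : 'I_n -> 'rV[R]_n -> R),
    0 < beta < 2 * pi ->
    is_domain Om -> Om `<=` sector n beta ->
    G1 `<=` bdry Om `&` bdry (sector n beta) ->
    Lp Om +oo%E c ->
    ('N[lebesgue_rV R n]_+oo [EFin \o (c^\+ \_ Om)%R] < c0%:E)%E ->
    W12 Om w Dw ->
    (exists Dwp, H10 Om G1 w^\+ Dwp) ->
    (forall phi Dphi, H10 Om G1 phi Dphi ->
       {ae lebesgue_rV R n, forall x, Om x -> 0 <= phi x} ->
       \int[lebesgue_rV R n]_(x in Om) (\sum_i Dw i x * Dphi i x)
       - \int[lebesgue_rV R n]_(x in Om) (c x * w x * phi x) <= 0) ->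
    (lebesgue_rV R n Om < (eta * beta)%:E)%E ->
    {ae lebesgue_rV R n, forall x, Om x -> w x <= 0}.
Proof.
move=> n2 c00.
have n0 : 0 < n%:R :> R by rewrite ltr0n (leq_trans _ n2).
(* the side of the boxes of translations, chosen to make 4 C c0 at most 1/2 *)
pose a : R := Num.min 1 (128 * n%:R * c0)^-1.
have a0 : 0 < a by rewrite lt_min ltr01 invr_gt0 !mulr_gt0.
have aC : 4 * (16 * n%:R * a ^+ 2) * c0 <= 2^-1.
  have a1 : a <= 1 by rewrite ge_min lexx.
  have a2 : a * (128 * n%:R * c0) <= 1.
    by rewrite -ler_pdivlMr ?mulr_gt0// div1r ge_min lexx orbT.
  have : 128 * n%:R * c0 * a ^+ 2 <= 128 * n%:R * c0 * a.
    by rewrite ler_pM2l ?mulr_gt0// expr2 ler_piMr// ltW.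
  by move: a2; rewrite mulrC; lra.
exists (a ^+ n / 16); first by rewrite divr_gt0// exprn_gt0.
move=> beta Om Gm c w Dw b02 [oOm _ _] OmS Gmb Lc Nc Ww [Dwp Hwp] weak muOm.
pose mu := lebesgue_rV R n; have mOm : measurable Om by exact: open_measurable_rV.
pose C := 16 * n%:R * a ^+ 2.
have C0 : 0 <= C by rewrite mulr_ge0 ?sqr_ge0 ?mulr_ge0// ltW.
have := poincare_H10 oOm C0 (fun phi tphi =>
  poincare_sector n2 a0 b02 oOm OmS Gmb muOm tphi) Hwp.
have [Wwp _] := Hwp; have [Lw LDw _] := Ww; have [Lwp LDwp _] := Wwp.
have mw := Lp_measurable oOm Lw; have mc := Lp_measurable oOm Lc.
have mwp := Lp_measurable oOm Lwp.
set N := (\int[mu]_(x in Om) (funrpos w x ^+ 2)%:E)%E.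
set E := (\sum_j \int[mu]_(x in Om) (Dwp j x ^+ 2)%:E)%E => NE.
have iN : mu.-integrable Om (EFin \o (funrpos w \* funrpos w)).
  exact: integrable_Lp2_mul.
have iE j : mu.-integrable Om (EFin \o (Dw j \* Dwp j)).
  exact: integrable_Lp2_mul.
have E_le : fine E <= \int[mu]_(x in Om) (\sum_j Dw j x * Dwp j x).
  have -> : fine E = \int[mu]_(x in Om) (\sum_j Dwp j x ^+ 2).
    rewrite /E -ge0_integral_sum//.
    - by congr fine; apply: eq_integral => x _; rewrite sumEFin.
    - move=> j; apply/measurable_EFinP; apply: measurable_funX.
      exact: Lp_measurable (LDwp j).
    - by move=> j x _; rewrite lee_fin sqr_ge0.
  apply: le_Rintegral_ae => //.
  - apply: measurable_sum => j; apply: measurable_funX.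
    exact: Lp_measurable (LDwp j).
  - rewrite (_ : EFin \o _ = fun x => (\sum_j (Dw j x * Dwp j x)%:E)%E); last first.
      by apply/funext => x /=; rewrite sumEFin.
    by apply: integrable_sum => // j _; exact: iE.
  - have := ae_forall_countable (gradient_funrpos oOm Ww Wwp).
    apply: filterS => x le Omx; split; last by apply: ler_sum => j _; exact: le.
    by apply: sumr_ge0 => j _; apply: le_trans (le j Omx); exact: sqr_ge0.
have N_ge : \int[mu]_(x in Om) (c x * w x * funrpos w x) <= c0 * fine N.
  rewrite -[fine N]/(\int[mu]_(x in Om) (funrpos w x ^+ 2)).
  have iN' : mu.-integrable Om (EFin \o (fun x => funrpos w x ^+ 2)) := iN.
  rewrite -RintegralZl//.
  apply: le_Rintegral_ae => //.
  - by apply: measurable_funM => //; exact: measurable_funM.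
  - exact: (integrableZl mOm c0 iN').
  - apply: filterS (ae_lt_of_Lnormy Nc) => x cx Omx; split.
      by rewrite mulr_ge0 ?sqr_ge0// ltW.
    rewrite -mulrA (_ : w x * _ = w^\+ x ^+ 2); first by rewrite ler_wpM2r ?sqr_ge0// cx.
    by rewrite /funrpos; case: (leP (w x) 0) => wx; rewrite ?mulr0 ?expr0n// expr2.
have := weak _ _ Hwp; rewrite subr_le0.
have wp0 : {ae mu, forall x, Om x -> 0 <= w^\+ x}.
  by apply: aeW => x _; exact: funrpos_ge0.
move=> /(_ wp0) energy.
have fN : N \is a fin_num.
  by rewrite ge0_fin_numE ?Lp2_sqr_lty//; apply: integral_ge0 => x _; rewrite lee_fin sqr_ge0.
have fE : E \is a fin_num.
  apply/sum_fin_numP => j _ _; rewrite ge0_fin_numE ?Lp2_sqr_lty//.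
  by apply: integral_ge0 => x _; rewrite lee_fin sqr_ge0.
have N0 : N = 0%E.
  have n0' : 0 <= fine N.
    by rewrite fine_ge0// integral_ge0// => x _; rewrite lee_fin sqr_ge0.
  have ec : fine E <= c0 * fine N by exact: le_trans E_le (le_trans energy N_ge).
  have ne : fine N <= 4 * C * fine E.
    by move: NE; rewrite -(fineK fN) -(fineK fE) -EFinM lee_fin.
  have : 4 * C * fine E <= 4 * C * (c0 * fine N).
    by rewrite ler_wpM2l// mulr_ge0.
  have : 4 * C * c0 * fine N <= 2^-1 * fine N by rewrite ler_wpM2r.
  rewrite -(fineK fN) mulrA => h1 h2; congr EFin; lra.
apply: filterS (ae_eq0_sqr mOm mwp N0) => x wx Omx.
by rewrite -(wx Omx) /funrpos le_max lexx.
Qed.
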